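(* Let $\delta$ be a rational space quartic curve in $\mathbb{C}\mathbb{P}^3$. If $\delta$ is of the first species, then for every $n$ there exist $n$ points on $\delta$ that span $\Theta(n^3)$ coplanar quadruples. If $\delta$ is of the second species, then any $n$ points on $\delta$ span $O(n^{8/3})$ coplanar quadruples.
   Context: A space quartic is an irreducible non-planar curve of degree $4$ in $\mathbb{C}\mathbb{P}^3$; every space quartic lies on some quadric surface. It is of the first species if it is contained in more than one quadric surface, and of the second species if it is contained in a unique quadric. A coplanar quadruple of a point set is a set of four distinct points of it lying on a common plane. *)

(* Defs.v *)
From HB Require Import structures.
From mathcomp Require Import all_boot all_algebra.
From mathcomp Require Import complex reals.
Set Implicit Arguments. Unset Strict Implicit. Unset Printing Implicit Defensive.
Import GRing.Theory Num.Theory.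
Local Open Scope ring_scope.

(* Points of CP^3 are represented by nonzero row vectors of C^4 (C = R[i]),
   taken up to nonzero scaling; a subset of CP^3 is a scaling-invariant
   predicate on 'rV_4. *)

Section Quartics.
Variable C : fieldType.

Definition proj_eq (m : nat) (p q : 'rV[C]_m) : Prop :=
  exists c : C, c != 0 /\ p = c *: q.

Definition quartic_monomials (u : 'rV[C]_2) : 'rV[C]_5 :=
  \row_(k < 5) (u 0 0 ^+ k * u 0 1 ^+ (4 - k)).

(* the map P^1 -> P^3, (s:t) |-> (f_0(s,t) : ... : f_3(s,t)), where column j
   of A holds the coefficients of the binary quartic form f_j *)
Definition qparam (A : 'M[C]_(5, 4)) (u : 'rV[C]_2) : 'rV[C]_4 :=
  quartic_monomials u *m A.

(* A defines a birational parametrization of a non-planar degree-4 curve: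
   - the four forms are linearly independent (image lies in no plane),
   - the forms have no common zero on P^1 (so the image has degree 4),
   - the map is injective outside finitely many parameter points
     (birational onto its image). *)
Definition quartic_param (A : 'M[C]_(5, 4)) : Prop :=
  [/\ row_full A,
      (forall u : 'rV[C]_2, u != 0 -> qparam A u != 0) &
      exists E : seq 'rV[C]_2,
        forall u v : 'rV[C]_2, u != 0 -> v != 0 ->
          (forall e, e \in E -> ~ proj_eq u e) ->
          (forall e, e \in E -> ~ proj_eq v e) ->
          proj_eq (qparam A u) (qparam A v) -> proj_eq u v].

Definition param_curve (A : 'M[C]_(5, 4)) (p : 'rV[C]_4) : Prop :=
  exists u : 'rV[C]_2, u != 0 /\ proj_eq p (qparam A u).

Definition rational_space_quartic (delta : 'rV[C]_4 -> Prop) : Prop :=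
  exists A : 'M[C]_(5, 4), quartic_param A /\ forall p, delta p <-> param_curve A p.

Definition qform (Q : 'M[C]_4) (p : 'rV[C]_4) : C := (p *m Q *m p^T) 0 0.

(* the quadric surface {qform Q = 0} (Q symmetric, nonzero) contains delta.
   Distinct quadric surfaces <-> non-proportional symmetric matrices. *)
Definition on_quadric (delta : 'rV[C]_4 -> Prop) (Q : 'M[C]_4) : Prop :=
  [/\ Q^T = Q, Q != 0 & forall p, delta p -> qform Q p = 0].

Definition first_species (delta : 'rV[C]_4 -> Prop) : Prop :=
  exists Q1 Q2 : 'M[C]_4,
    [/\ on_quadric delta Q1, on_quadric delta Q2 & forall c : C, Q2 != c *: Q1].

Definition second_species (delta : 'rV[C]_4 -> Prop) : Prop :=
  exists Q : 'M[C]_4, on_quadric delta Q /\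
    forall Q', on_quadric delta Q' -> exists c : C, Q' = c *: Q.

Definition points_on (delta : 'rV[C]_4 -> Prop) (n : nat) (P : 'I_n -> 'rV[C]_4) : Prop :=
  (forall i, delta (P i)) /\ (forall i j, i != j -> ~ proj_eq (P i) (P j)).

(* number of 4-element subsets {i<j<k<l} whose points lie on a common plane,
   i.e. whose representatives span a subspace of dimension <= 3 *)
Definition coplanar_quadruples (n : nat) (P : 'I_n -> 'rV[C]_4) : nat :=
  #|[set f : {ffun 'I_4 -> 'I_n} |
      [forall i : 'I_4, forall j : 'I_4, (i < j)%N ==> (f i < f j)%N] &&
      (\rank (\matrix_(k < 4) P (f k)) <= 3)%N]|.

End Quartics.

(* Main.v *)
Require Import Defs.
From HB Require Import structures.
From mathcomp Require Import all_boot all_order all_algebra.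
From mathcomp Require Import boolp complex reals.
From mathcomp Require Import ring lra zify.
Set Implicit Arguments. Unset Strict Implicit. Unset Printing Implicit Defensive.
Import Order.TTheory GRing.Theory Num.Theory.
Local Open Scope ring_scope.

(** Let [c] span the left kernel of the 5 x 4 matrix [A] of the parametrization.
    Four points with distinct parameters [u1], ..., [u4] are coplanar iff the
    binary quartic with these roots is apolar to [c], that is, iff the
    polarization [G (u1, u2, u3, u4)] of [c] vanishes.

    The curve is of the first species iff the Hankel determinant of [c] is [0].
    In that case the curve has a node or a cusp, [c] is a sum of two fourth
    powers or the degenerate form of such a sum, and in a suitable coordinate
    [G = 0] reads [y1 y2 y3 y4 = const] or [y1 + y2 + y3 + y4 = const]:
    geometric or arithmetic progressions have a cubic number of coplanar quadruples.

    Otherwise [(x, y) |-> G (x, y, _, _)] is an injective linear map from the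
    unordered pairs [{x, y}], seen as points of the plane P(Sym^2), to the lines of
    this plane, so that coplanar quadruples are incidences between n^2 points
    [{s, t}] and n^2 lines. A line [l] is a Moebius involution [phi], to which an
    argument in the style of Solymosi and Tardos applies. On the set S of
    the parameters which phi maps to parameters, the closed disc around s through its
    nearest neighbour [nu s <> phi s] in S contains few parameters for most s, because
    these discs cover each point a bounded number of times; their images under phi
    have the same property. The points [{s, phi s}] and [{nu s, phi (nu s)}]
    determine [l], and both [(s, nu s)] and [(phi s, phi (nu s))] are pairs of
    parameters in a common disc with at most m parameters. There are only O(n m) such
    pairs, since Delaunay graphs have linearly many edges (Clarkson and Shor).
    Taking m of order n^(1/3) gives O(n^(8/3)) incidences. *)

(** * Pairs of points in a common disc *)

(** A choice of related elements is an injection. Charging arguments thereby only have to say which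
    element may be charged, without an explicit function. *)
Lemma leq_card_injective_rel (A B : finType) (E : {set A}) (T : {set B})
    (r : A -> B -> Prop) :
  (forall a, a \in E -> exists2 b, b \in T & r a b) ->
  (forall a a' b, a \in E -> a' \in E -> r a b -> r a' b -> a = a') ->
  (#|E| <= #|T|)%N.
Proof.
move=> tot inj.
have [->|/set0Pn[a0 a0E]] := eqVneq E set0; first by rewrite cards0.
have [b0 _ _] := tot a0 a0E.
have /choice[f fP] : forall a, exists b, a \in E -> b \in T /\ r a b.
  move=> a; have [aE|aE] := boolP (a \in E); last by exists b0.
  by have [b bT rab] := tot a aE; exists b.
rewrite -(card_in_imset (f := f)).
  by apply/subset_leq_card/subsetP => _ /imsetP[a aE ->]; have [] := fP a aE.
move=> a a' aE a'E eqf; apply: (inj a a' (f a)) => //; first by have [] := fP a aE.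
by rewrite eqf; have [] := fP a' a'E.
Qed.

Lemma double_counting (A B : finType) (E : {set A}) (F : {set B}) (r : A -> B -> bool) :
  (\sum_(a in E) #|[set b in F | r a b]| = \sum_(b in F) #|[set a in E | r a b]|)%N.
Proof.
have card_sum (T : finType) (D : {set T}) (p : T -> bool) :
    #|[set x in D | p x]| = (\sum_(x in D) p x)%N.
  rewrite -sum1_card [RHS]big_mkcond [LHS]big_mkcond; apply: eq_bigr => x _.
  by rewrite inE; case: (x \in D); case: (p x).
under eq_bigr => a _ do rewrite card_sum.
by rewrite exchange_big; apply: eq_bigr => b _; rewrite card_sum.
Qed.

(** Naturals are pairwise distinct in characteristic zero, so one of the first [size s + 1] of them
    avoids [s]. This supplies generic shears and generic points of the projective line. *)
Lemma exists_natr_notin (R : numDomainType) (s : seq R) :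
  exists k : nat, k%:R \notin s.
Proof.
apply: contrapT => /forallNP all_in.
have sub : {subset [seq k%:R : R | k <- iota 0 (size s).+1] <= s}.
  by move=> _ /mapP[k _ ->]; apply/negPn/negP/all_in.
have /uniq_leq_size/(_ sub) : uniq [seq k%:R : R | k <- iota 0 (size s).+1].
  by rewrite map_inj_uniq ?iota_uniq // => i j /eqP; rewrite eqr_nat => /eqP.
by rewrite size_map size_iota ltnn.
Qed.

(** * Delaunay graphs have linearly many edges *)

Section Delaunay.
Variables (R : realFieldType) (I : finType) (X Y : I -> R) (t : R).
Hypothesis Xinj : injective X.

(** Equation of a circle at the point [(X k + t * Y k, Y k)], nonpositive on the closed disc. The
    coordinates are sheared by [t] to make all abscissas [X] distinct, and the affine part of the
    equation is written in the sheared coordinates. *)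
Definition lifted (d : R * R * R) (k : I) : R :=
  (X k + t * Y k) ^+ 2 + Y k ^+ 2 + d.1.1 * X k + d.1.2 * Y k + d.2.

(** Edges are oriented from left to right, so that each unordered pair occurs once. *)
Definition delaunay (T : {set I}) (e : I * I) : Prop :=
  [/\ e.1 \in T, e.2 \in T, X e.1 < X e.2 &
      exists d, [/\ lifted d e.1 <= 0, lifted d e.2 <= 0 &
        forall k, k \in T -> k != e.1 -> k != e.2 -> 0 < lifted d k]].

Definition slope (v k : I) : R := (Y k - Y v) / (X k - X v).
Definition height (e : I * I) (x : R) : R :=
  Y e.1 + slope e.1 e.2 * (x - X e.1).

Lemma height1 e : height e (X e.1) = Y e.1.
Proof. by rewrite /height subrr mulr0 addr0. Qed.

Lemma height_slope v b : X v < X b -> height (v, b) (X b) = Y b.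
Proof.
move=> lt; rewrite /height /slope /=; field.
by rewrite subr_eq0 eq_sym lt_eqF.
Qed.

Lemma lt_height v b w : X v < X w ->
  (Y w < height (v, b) (X w)) = (slope v w < slope v b).
Proof.
move=> lt; rewrite -[Y w](height_slope lt) /height /=.
by rewrite ltrD2l ltr_pM2r // subr_gt0.
Qed.

Lemma gt_height v b w : X v < X w ->
  (height (v, b) (X w) < Y w) = (slope v b < slope v w).
Proof.
move=> lt; rewrite -[Y w](height_slope lt) /height /=.
by rewrite ltrD2l ltr_pM2r // subr_gt0.
Qed.

Lemma le_height v b w : X v < X w ->
  (Y w <= height (v, b) (X w)) = (slope v w <= slope v b).
Proof. by move=> lt; rewrite leNgt gt_height // -leNgt. Qed.

Lemma ge_height v b w : X v < X w ->
  (height (v, b) (X w) <= Y w) = (slope v b <= slope v w).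
Proof. by move=> lt; rewrite leNgt lt_height // -leNgt. Qed.

Lemma segment_param e x : X e.1 < X e.2 -> X e.1 <= x -> x <= X e.2 ->
  exists l, [/\ 0 <= l, l <= 1, x = X e.1 + l * (X e.2 - X e.1) &
                height e x = Y e.1 + l * (Y e.2 - Y e.1)].
Proof.
move=> lt le1 le2; exists ((x - X e.1) / (X e.2 - X e.1)).
have gt0 : 0 < X e.2 - X e.1 by rewrite subr_gt0.
split.
- by rewrite divr_ge0 ?subr_ge0 // ltW.
- by rewrite ler_pdivrMr // mul1r lerD2r.
- by rewrite divfK ?gt_eqF // addrC subrK.
- by rewrite /height /slope; field; rewrite gt_eqF.
Qed.

(** A disc is convex, so a vertex on the edge lies in the disc that witnesses the edge. *)
Lemma delaunay_off_edge T e c : delaunay T e -> c \in T ->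
  X e.1 <= X c -> X c <= X e.2 -> Y c = height e (X c) -> c = e.1 \/ c = e.2.
Proof.
move=> [aT bT lt [d [da db dk]]] cT le1 le2 Yc.
have [->|ca] := eqVneq c e.1; first by left.
have [->|cb] := eqVneq c e.2; first by right.
have [l [l0 l1 Xc hc]] := segment_param lt le1 le2.
have := dk c cT ca cb; rewrite ltNge => /negP[].
rewrite /lifted Yc hc Xc.
apply: le_trans (_ : (1 - l) * lifted d e.1 + l * lifted d e.2 <= 0); last first.
  by rewrite -oppr_ge0 opprD -!mulrN addr_ge0 // mulr_ge0 ?oppr_ge0 ?subr_ge0.
rewrite -subr_ge0 /lifted.
set u := X e.1 + t * Y e.1; set v := X e.2 + t * Y e.2.
have -> : X e.1 + l * (X e.2 - X e.1) + t * (Y e.1 + l * (Y e.2 - Y e.1)) =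
  u + l * (v - u) by rewrite /u /v; ring.
(* The defect of convexity is [l * (1 - l)] times the squared length of the edge. *)
rewrite [leRHS](_ : _ = l * (1 - l) * ((v - u) ^+ 2 + (Y e.2 - Y e.1) ^+ 2)).
  by rewrite mulr_ge0 ?mulr_ge0 ?subr_ge0 // addr_ge0 ?sqr_ge0.
by ring.
Qed.

Lemma height_affine e x1 x2 l :
  height e ((1 - l) * x1 + l * x2) = (1 - l) * height e x1 + l * height e x2.
Proof. by rewrite /height; ring. Qed.

(** Here [d] is an affine form; it will be the difference of two disc equations, whose quadratic
    parts cancel. *)
Lemma delaunay_inside T e d x : delaunay T e -> X e.1 <= x <= X e.2 ->
  d.1.1 * X e.1 + d.1.2 * Y e.1 + d.2 < 0 ->
  d.1.1 * X e.2 + d.1.2 * Y e.2 + d.2 < 0 ->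
  d.1.1 * x + d.1.2 * height e x + d.2 < 0.
Proof.
case: d => [[p q] r] [_ _ lt _] /andP[le1 le2] /= n1 n2.
have [l [l0 l1 -> ->]] := segment_param lt le1 le2.
have -> : p * (X e.1 + l * (X e.2 - X e.1)) + q * (Y e.1 + l * (Y e.2 - Y e.1)) + r =
  (1 - l) * (p * X e.1 + q * Y e.1 + r) + l * (p * X e.2 + q * Y e.2 + r) by ring.
have [->|lN0] := eqVneq l 0; first by rewrite subr0 mul1r mul0r addr0.
rewrite -oppr_gt0 opprD -!mulrN ltr_wpDl // ?mulr_ge0 ?mulr_gt0 ?oppr_gt0 ?subr_ge0 //.
  by rewrite oppr_ge0 ltW.
by rewrite lt0r lN0.
Qed.

(* The difference of the two disc equations is affine, and it separates the
   open edges. *)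
Lemma delaunay_noncrossing T e f x1 x2 : delaunay T e -> delaunay T f ->
  X e.1 <= x1 <= X e.2 -> X f.1 <= x1 <= X f.2 ->
  X e.1 <= x2 <= X e.2 -> X f.1 <= x2 <= X f.2 ->
  height e x1 < height f x1 -> height e x2 <= height f x2.
Proof.
move=> De Df /andP[e1 e1'] /andP[f1 f1'] /andP[e2 e2'] /andP[f2 f2'] lt1.
rewrite leNgt; apply/negP => lt2.
have [aT bT ab [d [da db dk]]] := De; have [cT dT cd [g [gc gd gk]]] := Df.
have same v x : height e v = height f v -> height e x - height f x =
    (slope e.1 e.2 - slope f.1 f.2) * (x - v).
  move=> /eqP; rewrite -subr_eq0 => /eqP E0; rewrite -[LHS]subr0 -E0 /height; ring.
(* If the two lines meet at [v], the difference of heights is a multiple of [x - v], which cannot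
   change sign on one side of [v]. This settles edges with a common left or right end. *)
have contra v : height e v = height f v ->
    (v <= x1 /\ v <= x2) \/ (x1 <= v /\ x2 <= v) -> False.
  move=> hv; have h1 := same v x1 hv; have h2 := same v x2 hv.
  move: (slope _ _ - _) h1 h2 => k h1 h2.
  have k1 : k * (x1 - v) < 0 by rewrite -h1 subr_lt0.
  have k2 : 0 < k * (x2 - v) by rewrite -h2 subr_gt0.
  case=> -[v1 v2].
    have [k0|k0] := leP 0 k.
      by move: k1; rewrite ltNge mulr_ge0 // subr_ge0.
    by move: k2; rewrite ltNge mulr_le0_ge0 ?subr_ge0 // ltW.
  have [k0|k0] := leP 0 k.
    by move: k2; rewrite ltNge mulr_ge0_le0 // subr_le0.
  by move: k1; rewrite ltNge mulr_le0 ?subr_le0 // ltW.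
have [ac|ac] := eqVneq e.1 f.1.
  apply: (contra (X e.1)); last by left.
  by rewrite height1 ac height1.
have h2 k : delaunay T k -> height k (X k.2) = Y k.2.
  by case: k => k1 k2 [_ _ lt _]; rewrite height_slope.
have [bd|bd] := eqVneq e.2 f.2.
  apply: (contra (X e.2)); last by right.
  by rewrite h2 // bd h2.
have single : x1 = x2 -> False.
  by move=> x12; move: lt1; rewrite x12 ltNge ltW.
have [ad|ad] := eqVneq e.1 f.2.
  apply: single; apply/le_anti/andP; split.
    by apply: le_trans f1' _; rewrite -ad.
  by apply: le_trans f2' _; rewrite -ad.
have [bc|bc] := eqVneq e.2 f.1.
  apply: single; apply/le_anti/andP; split.
    by apply: le_trans e1' _; rewrite bc.
  by apply: le_trans e2' _; rewrite bc.
set u1 := height f x1 - height e x1; set u2 := height e x2 - height f x2.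
have u1p : 0 < u1 by rewrite subr_gt0.
have u2p : 0 < u2 by rewrite subr_gt0.
have [u1w u2w] := (ltW u1p, ltW u2p).
have u12 : 0 < u1 + u2 by rewrite addr_gt0.
(* This weight makes the affine difference of heights vanish at [x], the crossing point. *)
set l := u1 / (u1 + u2).
have l0 : 0 <= l by apply: divr_ge0 => //; apply: ltW.
have l1 : l <= 1 by rewrite /l ler_pdivrMr // mul1r lerDl.
set x := (1 - l) * x1 + l * x2.
have hx : height e x = height f x.
  rewrite /x !height_affine; apply/eqP; rewrite -subr_eq0; apply/eqP.
  transitivity (l * u2 - (1 - l) * u1); first by rewrite /u1 /u2; ring.
  by rewrite /l; field; rewrite gt_eqF.
have between y z : y <= x1 <= z -> y <= x2 <= z -> y <= x <= z.
  move=> /andP[y1 z1] /andP[y2 z2]; have -> : x = x1 + l * (x2 - x1) by rewrite /x; ring.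
  by apply/andP; split; nra.
(* [D] is negative at the ends of [e], which lie in the disc [d] and outside [g], and positive at
   the ends of [f]. The crossing point would have to satisfy both. *)
pose D := ((d.1.1 - g.1.1, d.1.2 - g.1.2), d.2 - g.2).
have DE k : D.1.1 * X k + D.1.2 * Y k + D.2 = lifted d k - lifted g k.
  by rewrite /lifted /D /=; ring.
have := @delaunay_inside T e D x De; rewrite !DE.
rewrite between ?e1 ?e2 // => /(_ isT).
rewrite !subr_lt0 (le_lt_trans da) ?(le_lt_trans db) ?gk //.
move=> /(_ isT isT) neg.
pose D' := ((- D.1.1, - D.1.2), - D.2).
have DE' k : D'.1.1 * X k + D'.1.2 * Y k + D'.2 = lifted g k - lifted d k.
  by rewrite /lifted /D' /D /=; ring.
have := @delaunay_inside T f D' x Df; rewrite !DE'.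
rewrite between ?f1 ?f2 // => /(_ isT).
rewrite !subr_lt0 (le_lt_trans gc) ?(le_lt_trans gd) ?dk // 1?eq_sym //.
move=> /(_ isT isT); rewrite -hx => neg'.
by move: neg neg'; rewrite /D' /D /=; lra.
Qed.

(** Of two edges in the same direction, the shorter one would end on the longer one. *)
Lemma slope_delaunay_inj T v b b' : delaunay T (v, b) -> delaunay T (v, b') ->
  slope v b = slope v b' -> b = b'.
Proof.
wlog le : b b' / X b <= X b' => [W D D' eqs|D D' eqs].
  by have [/W|/ltW/W W'] := leP (X b) (X b'); [exact|apply/esym/W'].
have [_ bT lt _] := D; have [] // := delaunay_off_edge D' bT (ltW lt) le.
  by rewrite -{1}(height_slope lt) /height eqs.
by move=> /= bv; move: lt; rewrite /= bv ltxx.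
Qed.

(* Kind [3]: [e] is the lowest edge going right from its left end [v].
   Otherwise [a] is the edge just below [e] at [v], and [e] is charged to the
   leftmost vertex of the cone between the two, which is the right end of [e]
   (kind [0]), the right end of the lower edge (kind [1]) or neither (kind [2]). *)
Definition charged (E : {set I * I}) (T : {set I}) (e : I * I) (c : I * 'I_4) :=
  if c.2 == 3%N :> nat then
    c.1 = e.1 /\ forall b, (e.1, b) \in E -> slope e.1 e.2 <= slope e.1 b
  else exists a,
    [/\ (e.1, a) \in E,
        forall b, (e.1, b) \in E -> slope e.1 b < slope e.1 e.2 ->
          slope e.1 b <= slope e.1 a,
        X e.1 < X c.1,
        forall z, z \in T -> X e.1 < X z ->
          slope e.1 a <= slope e.1 z -> slope e.1 z <= slope e.1 e.2 ->
          X c.1 <= X z &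
        [\/ [/\ c.2 = 0%N :> nat, c.1 = e.2 & slope e.1 a < slope e.1 c.1],
            [/\ c.2 = 1%N :> nat, c.1 = a & slope e.1 c.1 < slope e.1 e.2] |
            [/\ c.2 = 2%N :> nat, slope e.1 a < slope e.1 c.1 &
                slope e.1 c.1 < slope e.1 e.2]]].

Section Charging.
Variables (E : {set I * I}) (T : {set I}).
Hypothesis ET : forall e, e \in E -> delaunay T e.

(** The closed cone contains the right end of [e], so it has a leftmost vertex [w]. If [w] lies on a
    bounding edge, it is the right end of that edge, since an edge contains no further vertex; this
    gives kinds 0 and 1. *)
Lemma charged_exists e : e \in E ->
  exists2 c, c \in setX T [set: 'I_4] & charged E T e c.
Proof.
case: e => v b vb; have [/= vT bT lt _] := ET vb.
pose L := [set b' | ((v, b') \in E) && (slope v b' < slope v b)].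
have [low|] := eqVneq L set0.
  exists (v, inord 3); first by rewrite !inE vT.
  rewrite /charged /= inordK //=; split => // b' vb'.
  rewrite leNgt; apply/negP => lt'.
  by have := in_set0 b'; rewrite -low inE vb' lt'.
case/set0Pn => a0 a0P; case: (arg_maxP (slope v) a0P) => a aL amax.
have /[!inE]/andP[va ab] : a \in L := aL.
pose W := [set z in T | [&& X v < X z, slope v a <= slope v z & slope v z <= slope v b]].
have bW : b \in W by rewrite inE bT lt lexx (ltW ab).
case: (arg_minP X bW) => w wW wmin.
have /[!inE]/and4P[wT vw aw wb] : w \in W := wW.
have wmin' z : z \in T -> X v < X z -> slope v a <= slope v z ->
    slope v z <= slope v b -> X w <= X z.
  by move=> zT vz az zb; apply: wmin (_ : z \in W); rewrite inE zT vz az zb.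
have amax' b' : (v, b') \in E -> slope v b' < slope v b -> slope v b' <= slope v a.
  by move=> vb' lt'; apply: amax (_ : b' \in L); rewrite inE vb' lt'.
have [_ aT va' _] := ET va.
have onedge d : (v, d) \in E -> X w <= X d -> slope v w = slope v d -> w = d.
  move=> vd wd eqs; have [] // := delaunay_off_edge (ET vd) wT (ltW vw) wd.
    by rewrite -{1}(height_slope vw) /height eqs.
  by move=> /= wv; move: vw; rewrite wv ltxx.
have XWa : X w <= X a by apply: wmin' => //; apply: ltW.
have XWb : X w <= X b by apply: wmin' => //; apply: ltW.
have [wa|nwa] := eqVneq (slope v w) (slope v a).
  exists (w, inord 1); first by rewrite !inE wT.
  rewrite /charged /= inordK //=; exists a; split => //; constructor 2.
  by split; [| exact: onedge | rewrite wa].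
have aw' : slope v a < slope v w by rewrite lt_neqAle eq_sym nwa.
have [wb'|nwb] := eqVneq (slope v w) (slope v b).
  exists (w, inord 0); first by rewrite !inE wT.
  rewrite /charged /= inordK //=; exists a; split => //; constructor 1.
  by split; [| exact: onedge |].
exists (w, inord 2); first by rewrite !inE wT.
rewrite /charged /= inordK //=; exists a; split => //; constructor 3.
by split => //; rewrite lt_neqAle nwb.
Qed.

(** Cones of different edges at [v] meet at most along a boundary ray, and equal kinds exclude that
    the common vertex [c.1] lies there. Kind 3 occurs only for the lowest edge. *)
Lemma charged_same_left v b b' c : (v, b) \in E -> (v, b') \in E ->
  charged E T (v, b) c -> charged E T (v, b') c -> b = b'.
Proof.
move=> vb vb' Cb Cb'; have key d d' : (v, d) \in E -> slope v d < slope v d' ->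
    charged E T (v, d) c -> charged E T (v, d') c -> False.
  rewrite /charged /= => vd lt; case: eqP => [_ [_ lo] [_ lo']|_].
    by move: lt; rewrite ltNge lo'.
  move=> [a [va amax vw wmin kind]] [a' [va' amax' vw' wmin' kind']].
  have da' := amax' _ vd lt.
  case: kind => [[k0 cd ac]|[k0 ca cd]|[k0 ac cd]];
  case: kind' => [[k0' cd' ac']|[k0' ca' cd']|[k0' ac' cd']];
    try by rewrite k0 in k0'.
  - by move: lt; rewrite -cd -cd' ltxx.
  - by move: (lt_le_trans cd da'); rewrite -ca' ltxx.
  - by have := lt_trans (lt_le_trans cd da') ac'; rewrite ltxx.
have [lt|lt|] := ltgtP (slope v b) (slope v b').
- by have := key _ _ vb lt Cb Cb'.
- by have := key _ _ vb' lt Cb' Cb.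
- exact: slope_delaunay_inj (ET vb) (ET vb').
Qed.

(** The vertex [v'] is to the left of [w], hence outside the cone at [v]. If it is above the cone,
    the lower edge at [v'] starts above [(v, b)] but passes weakly below [w], while [(v, b)] passes
    weakly above it. Equal kinds make one of these inequalities strict, so the edges cross. The case
    below is symmetric. *)
Lemma charged_cross e e' c : e \in E -> e' \in E -> X e.1 < X e'.1 ->
  charged E T e c -> charged E T e' c -> False.
Proof.
case: e e' => [v b] [v' b'] vb vb' /= vv'; rewrite /charged /=.
case: c => w k /=; case: eqP => [_ [wv _] [wv' _]|_].
  by move: vv'; rewrite -wv -wv' ltxx.
move=> [a [va amax vw wmin kind]] [a' [va' amax' vw' wmin' kind']].
have [_ bT ltb _] := ET vb; have [_ aT lta _] := ET va.
have [v'T b'T ltb' _] := ET vb'; have [_ a'T lta' _] := ET va'.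
rewrite /= in bT ltb aT lta v'T b'T ltb' a'T lta'.
have ranges : [/\ slope v a <= slope v w, slope v w <= slope v b,
   slope v' a' <= slope v' w & slope v' w <= slope v' b'].
  have mid i x y z u : [\/ [/\ i = 0%N, u = z & slope x y < slope x u],
      [/\ i = 1%N, u = y & slope x u < slope x z] |
      [/\ i = 2%N, slope x y < slope x u & slope x u < slope x z]] ->
      slope x y <= slope x u /\ slope x u <= slope x z.
    by case=> -[_]; [move=> <- /ltW | move=> <- /ltW | move=> /ltW ? /ltW].
  by have [? ?] := mid _ _ _ _ _ kind; have [? ?] := mid _ _ _ _ _ kind'; split.
have [aw wb aw' wb'] := ranges.
have XWa : X w <= X a.
  apply: wmin => //; apply: le_trans aw wb.
have XWb : X w <= X b by apply: wmin => //; apply: le_trans aw wb.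
have XWa' : X w <= X a'.
  apply: wmin' => //; apply: le_trans aw' wb'.
have XWb' : X w <= X b' by apply: wmin' => //; apply: le_trans aw' wb'.
have noncross p q : p \in E -> q \in E -> X p.1 <= X v' -> X w <= X p.2 ->
    X q.1 <= X v' -> X w <= X q.2 ->
    height p (X v') < height q (X v') -> height p (X w) <= height q (X w).
  move=> pE qE p1 p2 q1 q2; have vw'W := ltW vw'.
  by apply: (delaunay_noncrossing (ET pE) (ET qE)); apply/andP; split;
    rewrite // ?(le_trans _ vw'W) // (le_trans vw'W).
have [up|lo] := ltP (slope v b) (slope v v').
  have := noncross (v, b) (v', a') vb va' (ltW vv') XWb (lexx _) XWa'.
  rewrite height1 gt_height // => /(_ up).
  have le1 : Y w <= height (v, b) (X w) by rewrite le_height.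
  have le2 : height (v', a') (X w) <= Y w by rewrite ge_height.
  apply/negP; rewrite -ltNge.
  case: kind kind' => [[k0 _ _]|[k0 _ cd]|[k0 _ cd]] [[k0' _ ac']|[k0' _ cd']|[k0' ac' _]];
    try by rewrite k0 in k0'.
  - by apply: lt_le_trans le1; rewrite gt_height.
  - by apply: (le_lt_trans le2); rewrite lt_height.
  - by apply: (le_lt_trans le2); rewrite lt_height.
have {}lo : slope v v' < slope v a.
  rewrite ltNge; apply/negP => av'.
  by move: vw'; rewrite ltNge wmin.
have := noncross (v', b') (v, a) vb' va (lexx _) XWb' (ltW vv') XWa.
rewrite height1 lt_height // => /(_ lo).
have le1 : Y w <= height (v', b') (X w) by rewrite le_height.
have le2 : height (v, a) (X w) <= Y w by rewrite ge_height.
apply/negP; rewrite -ltNge.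
case: kind kind' => [[k0 _ ac]|[k0 _ cd]|[k0 ac _]] [[k0' _ _]|[k0' _ cd']|[k0' _ cd']];
  try by rewrite k0 in k0'.
- by apply: lt_le_trans le1; rewrite gt_height.
- by apply: (le_lt_trans le2); rewrite lt_height.
- by apply: (le_lt_trans le2); rewrite lt_height.
Qed.

(** A vertex receives at most one charge of each of the four kinds. *)
Lemma card_delaunay : (#|E| <= 4 * #|T|)%N.
Proof.
have <- : #|setX T [set: 'I_4]| = (4 * #|T|)%N.
  by rewrite cardsX cardsT card_ord mulnC.
apply: leq_card_injective_rel charged_exists _ => -[v b] [v' b'] c vb vb' C C'.
have [lt|lt|/Xinj /= eqv] := ltgtP (X (v, b).1) (X (v', b').1).
- by have := charged_cross vb vb' lt C C'.
- by have := charged_cross vb' vb lt C' C.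
- by subst v'; rewrite (charged_same_left vb vb' C C').
Qed.
End Charging.

(** * Random colourings *)

Section Sampling.
Variables (m : nat) (i j : I) (D : {set I}).
Hypotheses (m_gt0 : (0 < m)%N) (ij : i != j) (cardD : (#|D| <= m)%N).
Local Notation q := (2 * m)%N.
Local Notation colouring := {ffun I -> 'I_q}.

Definition isolated (f : colouring) :=
  (f i == f j) && [forall k in D, (k != i) && (k != j) ==> (f k != f i)].

Let recolour (f : colouring) k c : colouring := [ffun x => if x == k then c else f x].
Let F2 := [set f : colouring | f i == f j].
Let F3 k := [set f : colouring | (f i == f j) && (f k == f i)].

(** Giving [j] the colour of [i] loses only the old colour of [j], which is recorded. *)
Lemma card_monochromatic_pair : (#|colouring| <= q * #|F2|)%N.
Proof.
have <- : #|setX F2 [set: 'I_q]| = (q * #|F2|)%N.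
  by rewrite cardsX cardsT card_ord mulnC.
rewrite -cardsT.
apply: (leq_card_injective_rel (r := fun f c => c = (recolour f j (f i), f j))).
  move=> f _; exists (recolour f j (f i), f j) => //.
  by rewrite !inE !ffunE eqxx (negPf ij) eqxx.
move=> f g _ _ _ -> [/ffunP eqr eqj]; apply/ffunP => x.
by have := eqr x; rewrite !ffunE; case: eqP => [->|].
Qed.

(** Recolouring [k] arbitrarily can be undone, because its former colour was that of [i]. *)
Lemma card_monochromatic_triple k : k != i -> k != j -> (q * #|F3 k| <= #|F2|)%N.
Proof.
move=> ki kj; have <- : #|setX (F3 k) [set: 'I_q]| = (q * #|F3 k|)%N.
  by rewrite cardsX cardsT card_ord mulnC.
apply: (leq_card_injective_rel (r := fun c f => f = recolour c.1 k c.2)).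
  move=> [f c]; rewrite !inE /= andbT => /andP[fij _].
  by exists (recolour f k c); rewrite ?inE // !ffunE !(eq_sym _ k) (negPf ki) (negPf kj).
move=> [f c] [g d] h; rewrite !inE /= !andbT => /andP[_ /eqP fk] /andP[_ /eqP gk] ->.
move=> /ffunP eqr; congr pair.
  apply/ffunP => x; have := eqr x; rewrite !ffunE; case: eqP => // -> _.
  by rewrite fk gk; have := eqr i; rewrite !ffunE eq_sym (negPf ki).
by have := eqr k; rewrite !ffunE eqxx.
Qed.

(** A union bound: each of the at most [m] other points of [D] has the colour of [i] in at most a
    fraction [1 / (2 m)] of the colourings in [F2], so at least half of [F2] remains. *)
Lemma card_isolated : (#|colouring| <= 2 * q * #|[set f | isolated f]|)%N.
Proof.
pose D' := [set k in D | (k != i) && (k != j)].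
have sub : F2 \subset [set f | isolated f] :|: \bigcup_(k in D') F3 k.
  apply/subsetP => f; rewrite !inE /isolated => fij; rewrite fij /=.
  case: (boolP [forall k in D, _]) => //= /forall_inPn[k kD].
  rewrite negb_imply negbK => /andP[kij fk].
  by apply/bigcupP; exists k; rewrite !inE ?kD ?kij ?fij.
have cardF3 : (2 * \sum_(k in D') #|F3 k| <= #|F2|)%N.
  rewrite -(leq_pmul2l m_gt0) mulnA (mulnC m) big_distrr /=.
  apply: leq_trans (_ : #|D'| * #|F2| <= _)%N; last first.
    rewrite leq_mul2r (leq_trans _ cardD) ?orbT // subset_leq_card //.
    by apply/subsetP => k; rewrite inE => /andP[].
  rewrite -sum_nat_const; apply: leq_sum => k; rewrite inE => /and3P[_ ki kj].
  exact: card_monochromatic_triple.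
have cardU : (#|\bigcup_(k in D') F3 k| <= \sum_(k in D') #|F3 k|)%N.
  elim/big_rec2: _ => [|k a B _ le]; first by rewrite cards0.
  by apply: leq_trans (leq_card_setU _ _) _; rewrite leq_add2l.
have := subset_leq_card sub.
have [+ _] := leq_card_setU [set f | isolated f] (\bigcup_(k in D') F3 k).
have := card_monochromatic_pair.
move=> le le1 le2; apply: leq_trans le _.
have {le1 le2} le1 : (#|F2| <= 2 * #|[set f | isolated f]|)%N by lia.
by apply: leq_trans (leq_mul (leqnn q) le1) _; apply: eq_leq; ring.
Qed.

End Sampling.

(* Clarkson-Shor: in a random colouring with [2 m] colours, a pair in a common
   disc with at most [m] points is a Delaunay edge of its colour class with
   probability at least [1 / (4 m)]. *)
Lemma card_close_pairs (m : nat) (E : {set I * I}) : (0 < m)%N ->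
  (forall e, e \in E -> X e.1 < X e.2 /\ exists d,
     [/\ lifted d e.1 <= 0, lifted d e.2 <= 0 &
         (#|[set k | (lifted d k <= 0)%R]| <= m)%N]) ->
  (#|E| <= 16 * m * #|I|)%N.
Proof.
move=> m0 EP; pose q := (2 * m)%N.
have /choice[D DP] : forall e, exists d, e \in E ->
     [/\ lifted d e.1 <= 0, lifted d e.2 <= 0 &
         (#|[set k | (lifted d k <= 0)%R]| <= m)%N].
  move=> e; have [eE|_] := boolP (e \in E); last by exists (0, 0, 0).
  by have [_ [d dP]] := EP e eE; exists d.
pose disc e := [set k | lifted (D e) k <= 0].
pose good (e : I * I) (f : {ffun I -> 'I_q}) := isolated e.1 e.2 (disc e) f.
(* Good pairs of colour [c] are Delaunay edges of the class of [c], and the classes partition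
   [I]. *)
have per_colouring f : (#|[set e in E | good e f]| <= 4 * #|I|)%N.
  pose Ec c := [set e in E | good e f & f e.1 == c].
  apply: leq_trans (_ : \sum_c #|Ec c| <= _)%N.
    apply: leq_trans (_ : #|\bigcup_c Ec c| <= _)%N.
      apply/subset_leq_card/subsetP => e; rewrite inE => /andP[eE ge].
      by apply/bigcupP; exists (f e.1); rewrite // inE eE ge eqxx.
    elim/big_rec2: _ => [|c a B _ le]; first by rewrite cards0.
    by apply: leq_trans (leq_card_setU _ _) _; rewrite leq_add2l.
  apply: leq_trans (_ : \sum_c 4 * #|[set k | f k == c]| <= _)%N.
    apply: leq_sum => c _; apply: card_delaunay => e.
    rewrite inE => /and3P[eE /andP[/eqP eqf /forall_inP iso] /eqP fc].
    have [lt _] := EP e eE; have [d1 d2 _] := DP e eE.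
    split; rewrite ?inE -?eqf ?fc //; exists (D e); split => // k.
    rewrite inE => /eqP fk k1 k2; rewrite ltNge; apply/negP => kD.
    by have := iso k; rewrite inE kD k1 k2 fk fc eqxx => /(_ isT).
  rewrite -big_distrr leq_pmul2l //=.
  have := double_counting [set: 'I_q] [set: I] (fun c k => f k == c).
  rewrite (eq_bigl xpredT) => [|c]; last by rewrite inE.
  have setTE c : [set k in [set: I] | f k == c] = [set k | f k == c].
    by apply/setP => k; rewrite !inE.
  under eq_bigr => c _ do rewrite setTE.
  move=> ->; rewrite -cardsT -sum1_card leq_sum // => k _.
  rewrite (_ : [set a in _ | _] = [set f k]) ?cards1 //.
  by apply/setP => c; rewrite !inE eq_sym.
have := double_counting E [set: {ffun I -> 'I_q}] good.
set N := #|{ffun I -> 'I_q}| => dc.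
have N0 : (0 < N)%N.
  have q0 : (0 < q)%N by rewrite muln_gt0.
  by apply/card_gt0P; exists [ffun=> Ordinal q0].
rewrite -(leq_pmul2r N0).
(* Each pair of [E] is good for at least [N / (2 * q)] colourings; counting by colourings then gives
   [2 * q * 4 = 16 * m]. *)
apply: leq_trans (_ : 2 * q * \sum_(e in E) #|[set f in [set: {ffun I -> 'I_q}] | good e f]| <= _)%N.
  rewrite big_distrr -sum_nat_const /=; apply: leq_sum => e eE.
  have [lt _] := EP e eE; have [_ _ cardD] := DP e eE.
  rewrite (_ : [set f in _ | _] = [set f | good e f]); last by apply/setP => f; rewrite !inE.
  by apply: card_isolated => //; apply: contraTneq lt => ->; rewrite ltxx.
rewrite dc; apply: leq_trans (_ : 2 * q * (N * (4 * #|I|)) <= _)%N.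
  have -> : (N * (4 * #|I|) = \sum_(f in [set: {ffun I -> 'I_q}]) 4 * #|I|)%N.
    by rewrite sum_nat_const cardsT.
  by apply: leq_mul => //; apply: leq_sum => f _; apply: per_colouring.
by rewrite /q; apply: eq_leq; ring.
Qed.
End Delaunay.

(** * Rich Moebius involutions *)

Section RichLines.
Variable R : rcfType.
Local Notation C := R[i].

Definition normsq (z : C) : R := complex.Re z ^+ 2 + complex.Im z ^+ 2.

Lemma normsq_ge0 z : 0 <= normsq z.
Proof. by rewrite addr_ge0 ?sqr_ge0. Qed.

Lemma normsq_eq0 z : (normsq z == 0) = (z == 0).
Proof. by case: z => x y; rewrite paddr_eq0 ?sqr_ge0 // !sqrf_eq0 eq_complex. Qed.

Lemma normsq0 : normsq 0 = 0.
Proof. by apply/eqP; rewrite normsq_eq0. Qed.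

Lemma normsq_gt0 z : (0 < normsq z) = (z != 0).
Proof. by rewrite lt0r normsq_ge0 andbT normsq_eq0. Qed.

Lemma normsqM z w : normsq (z * w) = normsq z * normsq w.
Proof. by case: z w => [x y] [u v]; rewrite /normsq /=; ring. Qed.

Definition octant (z : C) : bool * bool * bool :=
  (0 <= complex.Re z, 0 <= complex.Im z, `|complex.Re z| <= `|complex.Im z|).

(* Directions in a common octant differ by at most 45 < 60 degrees. *)
Lemma octant_lt u v : octant u = octant v -> v != 0 -> normsq v <= normsq u ->
  normsq (u - v) < normsq u.
Proof.
rewrite -normsq_gt0; case: u v => [x1 y1] [x2 y2]; rewrite /octant /normsq /=.
move=> [sx sy sxy] v0 le.
pose d := x1 * x2 + y1 * y2; pose c := x1 * y2 - x2 * y1.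
suff : x2 ^+ 2 + y2 ^+ 2 < 2 * d by rewrite /d; nra.
have xx : x1 * x2 = `|x1| * `|x2|.
  have [h|h] := leP 0 x1; first by rewrite !ger0_norm -?sx.
  by rewrite !ltr0_norm ?mulrNN // ltNge -sx -ltNge.
have yy : y1 * y2 = `|y1| * `|y2|.
  have [h|h] := leP 0 y1; first by rewrite !ger0_norm -?sy.
  by rewrite !ltr0_norm ?mulrNN // ltNge -sy -ltNge.
have d0 : 0 <= d by rewrite /d xx yy addr_ge0 ?mulr_ge0.
pose c' := `|x1| * `|y2| - `|x2| * `|y1|.
(* Lagrange's identity for the cross product [c'] and the inner product [d]. As the angle is at most
   45 degrees, [c' ^+ 2 <= d ^+ 2], so that the squared norms [A] of [u] and [B] of [v] satisfy [B
   ^+ 2 <= A * B <= 2 * d ^+ 2 < 4 * d ^+ 2]. *)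
have cc : c' ^+ 2 + d ^+ 2 = (x1 ^+ 2 + y1 ^+ 2) * (x2 ^+ 2 + y2 ^+ 2).
  rewrite -(real_normK (num_real x1)) -(real_normK (num_real x2)).
  by rewrite -(real_normK (num_real y1)) -(real_normK (num_real y2)) /c' /d xx yy; ring.
have dc : c' ^+ 2 <= d ^+ 2.
  rewrite /d xx yy /c'.
  have := normr_ge0 x1; have := normr_ge0 x2; have := normr_ge0 y1; have := normr_ge0 y2.
  have [h1|h1] := leP `|x1| `|y1|.
    have h2 : `|x2| <= `|y2| by rewrite -sxy.
    move: h1 h2; move: `|x1| `|x2| `|y1| `|y2| => p1 p2 q1 q2 *.
    rewrite -subr_ge0 subr_sqr mulr_ge0 //; nra.
  have h2 : `|y2| < `|x2| by rewrite ltNge -sxy -ltNge.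
  move: h1 h2; move: `|x1| `|x2| `|y1| `|y2| => p1 p2 q1 q2 *.
  rewrite -subr_ge0 subr_sqr mulr_ge0 //; nra.
move: v0 le cc dc d0; move: (x1 ^+ 2 + y1 ^+ 2) (x2 ^+ 2 + y2 ^+ 2) => A B.
move: d c' => d' e' *; nra.
Qed.

Variables (I : finType) (a : I -> C).
Hypothesis a_inj : injective a.

(** Around [z], take the farthest centre [s] in an octant. Any other centre in this octant is closer
    to [s] than [z] is, hence closer than [nu s], so it can only be [sg s]. Eight octants with two
    centres each and [z] itself make 17. *)
Lemma nearest_overlap (S : {set I}) (sg nu : I -> I) (z : C) :
  (forall s s', s \in S -> s' \in S -> s' != s -> s' != sg s ->
     normsq (a s - a (nu s)) <= normsq (a s - a s')) ->
  (#|[set s in S | (normsq (a s - z) <= normsq (a s - a (nu s)))%R]| <= 17)%N.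
Proof.
move=> near; set Z := [set s in S | _].
pose Zc c := [set s in Z | (a s != z) && (octant (a s - z) == c)].
have Zc2 c : (#|Zc c| <= 2)%N.
  have [->|/set0Pn[s0 s0Z]] := eqVneq (Zc c) set0; first by rewrite cards0.
  case: (@arg_maxP _ _ _ s0 (mem (Zc c)) (fun s => normsq (a s - z)) s0Z) => s sZ smax.
  have /[!inE]/andP[/andP[sS szle] /andP[sz /eqP so]] : s \in Zc c := sZ.
  apply: leq_trans (_ : #|[set s; sg s]| <= _)%N; last by rewrite cards2; case: eqP.
  apply/subset_leq_card/subsetP => s' s'Z; rewrite !inE.
  have /[!inE]/andP[/andP[s'S s'zle] /andP[s'z /eqP s'o]] := s'Z.
  apply: contraT; rewrite negb_or => /andP[s's s'sg].
  have := near s s' sS s'S s's s'sg; rewrite leNgt.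
  rewrite (lt_le_trans _ szle) // -(subrKA z) -[z - _]opprB.
  apply: octant_lt; rewrite ?so ?s'o ?subr_eq0 //; exact: (smax s').
have sub : Z \subset [set s | a s == z] :|: \bigcup_c Zc c.
  apply/subsetP => s sZ; rewrite !inE; case: eqVneq => //= sz.
  by apply/bigcupP; exists (octant (a s - z)) => //; rewrite inE sZ sz eqxx.
apply: leq_trans (subset_leq_card sub) _.
apply: leq_trans (leq_card_setU _ _).1 _.
apply: (@leq_add _ _ 1 16).
  by apply/card_le1_eqP => x y; rewrite !inE => /eqP <- /eqP /a_inj ->.
apply: leq_trans (_ : \sum_c #|Zc c| <= _)%N.
  elim/big_rec2: _ => [|k b B _ le]; first by rewrite cards0.
  by apply: leq_trans (leq_card_setU _ _) _; rewrite leq_add2l.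
apply: leq_trans (_ : \sum_(c : bool * bool * bool) 2 <= _)%N; first exact: leq_sum.
by rewrite sum_nat_const !card_prod card_bool.
Qed.

(** * Close pairs, and lines as Moebius involutions *)

Definition close (m : nat) (i j : I) : Prop :=
  i != j /\ exists d : R * R * R, let disc z :=
      normsq z + d.1.1 * complex.Re z + d.1.2 * complex.Im z + d.2 in
    [/\ disc (a i) <= 0, disc (a j) <= 0 & (#|[set k | (disc (a k) <= 0)%R]| <= m)%N].

(** Equation of a line in the coordinates [(1, s + t, s * t)] of the unordered pair [{s, t}]. Solved
    for [t], it is the involution [t = - (l0 + l1 * s) / (l1 + l2 * s)]. *)
Definition line_form (l : C * C * C) (s t : C) : C :=
  l.1.1 + l.1.2 * (s + t) + l.2 * (s * t).

(** Up to sign, the determinant of the involution; it vanishes on the tangents to the conic of the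
    pairs [{s, s}]. *)
Definition line_disc (l : C * C * C) : C := l.1.2 ^+ 2 - l.1.1 * l.2.

Lemma line_formC l s t : line_form l s t = line_form l t s.
Proof. by rewrite /line_form; ring. Qed.

Lemma pole_not_partner l s t : line_disc l != 0 -> line_form l s t = 0 ->
  l.1.2 + l.2 * s != 0.
Proof.
case: l => [[l0 l1] l2]; rewrite /line_disc /line_form /= => nd st.
apply: contra nd => /eqP e; apply/eqP.
have e0 : l0 + l1 * s = 0 by rewrite -[RHS]st -[LHS]addr0 -(mul0r t) -e; ring.
by rewrite -[RHS](mulr0 l1) -e -[LHS]addr0 -(mul0r l2) -e0; ring.
Qed.

(** Every pair on a tangent contains the double point of the tangent. *)
Lemma degenerate_factor l s t : line_disc l = 0 -> line_form l s t = 0 ->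
  (l.1.2 + l.2 * s) * (l.1.2 + l.2 * t) = 0.
Proof.
move=> d st; transitivity (line_disc l + l.2 * line_form l s t).
  by rewrite /line_disc /line_form; ring.
by rewrite d st mulr0 addr0.
Qed.

Lemma degenerate_multiple l s t : l.1.2 + l.2 * s = 0 -> line_form l s t = 0 ->
  l = (l.2 * s ^+ 2, l.2 * - s, l.2 * 1).
Proof.
case: l => [[l0 l1] l2]; rewrite /line_form /= => s0 st.
have -> : l1 = l2 * - s by rewrite -[RHS]add0r -s0; ring.
rewrite mulr1; congr (_, _, _).
transitivity (l2 * s ^+ 2 + (l0 + l1 * (s + t) + l2 * (s * t)) -
    (l1 + l2 * s) * (s + t)); first by ring.
by rewrite st s0 mul0r subr0 addr0.
Qed.

Lemma line_partner_uniq l s t t' : line_disc l != 0 ->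
  line_form l s t = 0 -> line_form l s t' = 0 -> t = t'.
Proof.
move=> nd st st'; have := pole_not_partner nd st => /mulfI; apply.
apply/eqP; rewrite -subr_eq0 -[X in _ == X](subrr 0) -{1}st -{1}st' /line_form; apply/eqP; ring.
Qed.

(** Expresses the distance from [s] to the partner [s'] of [w] without a division. *)
Lemma line_form_sub l s s' w : line_form l s' w = 0 ->
  line_form l s w = (s - s') * (l.1.2 + l.2 * w).
Proof. by move=> e; rewrite -[LHS]subr0 -e /line_form; ring. Qed.

(* The condition [normsq (s - z) <= r] for the partner [z] of [w] on [l] is a
   quadratic condition on [w] with a leading coefficient which is positive
   as soon as the pole [- l1 / l2] of [l] is not in the disc. *)
Lemma line_disc_image l s r : normsq l.2 * r < normsq (l.1.2 + l.2 * s) ->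
  exists d : R * R * R, forall w,
    (normsq w + d.1.1 * complex.Re w + d.1.2 * complex.Im w + d.2 <= 0) =
    (normsq (line_form l s w) <= r * normsq (l.1.2 + l.2 * w)).
Proof.
case: l => [[l0 l1] l2] /=; rewrite -subr_gt0.
set K := _ - _ => K0.
have [p [q [c pqc]]] : exists p q c, forall w,
    normsq (line_form (l0, l1, l2) s w) - r * normsq (l1 + l2 * w) =
    K * normsq w + p * complex.Re w + q * complex.Im w + c.
  rewrite /K /line_form /normsq; case: l0 l1 l2 s {K K0} => [a0 b0] [a1 b1] [a2 b2] [x y] /=.
  pose ux := a1 + (a2 * x - b2 * y); pose uy := b1 + (a2 * y + b2 * x).
  pose vx := a0 + (a1 * x - b1 * y); pose vy := b0 + (a1 * y + b1 * x).
  exists (2 * (ux * vx + uy * vy) - r * 2 * (a2 * a1 + b2 * b1)).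
  exists (2 * (ux * vy - uy * vx) - r * 2 * (a2 * b1 - b2 * a1)).
  exists (vx ^+ 2 + vy ^+ 2 - r * (a1 ^+ 2 + b1 ^+ 2)).
  by case=> u v /=; rewrite /ux /uy /vx /vy; ring.
exists (p / K, q / K, c / K) => w /=.
rewrite -[RHS]subr_le0 pqc -[RHS](pmulr_rle0 _ (_ : 0 < K^-1)) ?invr_gt0 //.
congr (_ <= _); field; by rewrite gt_eqF.
Qed.

(** With three elements in [S], one is left after removing [s] and [sg s]. *)
Lemma nearest_exists (S : {set I}) (sg : I -> I) : (2 < #|S|)%N ->
  exists nu : I -> I, forall s, s \in S ->
    [/\ nu s \in S, nu s != s, nu s != sg s & forall s', s' \in S -> s' != s ->
      s' != sg s -> normsq (a s - a (nu s)) <= normsq (a s - a s')].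
Proof.
move=> S3; suff /choice[nu nuP] : forall s, exists s1, s \in S ->
    [/\ s1 \in S, s1 != s, s1 != sg s & forall s', s' \in S -> s' != s ->
      s' != sg s -> normsq (a s - a s1) <= normsq (a s - a s')] by exists nu.
move=> s; have [sS|_] := boolP (s \in S); last by exists s.
pose S' := S :\: [set s; sg s].
have /set0Pn[s0 s0S] : S' != set0.
  apply: contraTneq S3 => /eqP; rewrite setD_eq0 -leqNgt => sub.
  by apply: leq_trans (subset_leq_card sub) _; rewrite cards2; case: eqP.
case: (@arg_minP _ _ _ s0 (mem S') (fun s' => normsq (a s - a s')) s0S) => s1 s1S smin.
have /[!inE]/andP[] : s1 \in S' := s1S.
rewrite negb_or => /andP[s1s s1sg] s1S'; exists s1 => _; split => // s' s'S s's s'sg.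
by apply: smin (_ : s' \in S'); rewrite !inE negb_or s's s'sg.
Qed.

(** Markov's inequality: the sizes of the sets [W s] add up to at most [17 * #|I|]. *)
Lemma card_many_points (S : {set I}) (W : I -> {set I}) m :
  (forall k, (#|[set s in S | k \in W s]| <= 17)%N) ->
  (#|[set s in S | (m < #|W s|)%N]| * m <= 17 * #|I|)%N.
Proof.
move=> Wk; rewrite -sum_nat_const.
apply: leq_trans (_ : \sum_(s in S) #|W s| <= _)%N.
  rewrite [X in (_ <= X)%N](bigID (fun s => m < #|W s|)%N) /=.
  apply: leq_trans (leq_addr _ _); rewrite big_mkcond [X in (_ <= X)%N]big_mkcond /=.
  by apply: leq_sum => s _; rewrite inE; case: ifP => // /andP[_ /ltnW].
have := double_counting S [set: I] (fun s k => k \in W s).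
have setTE s : [set k in [set: I] | k \in W s] = W s by apply/setP => k; rewrite !inE.
under eq_bigr => s _ do rewrite setTE.
move=> ->; rewrite mulnC -cardsT -sum_nat_const; exact: leq_sum.
Qed.

(** Three kinds of [s] are discarded: the disc through the nearest neighbour has more than [m]
    points ([B1]), its image under the involution has ([B2]), or the disc contains the pole ([B3]).
    Each costs [17 * #|I|] by the overlap bound, at a parameter, at its partner and at the pole
    respectively. *)
Lemma rich_line l (S : {set I}) (sg : I -> I) m :
  line_disc l != 0 -> (m <= #|I|)%N ->
  (forall s, s \in S -> line_form l (a s) (a (sg s)) = 0) ->
  exists (G : {set I}) (nu : I -> I), (#|S| * m <= #|G| * m + 51 * #|I|)%N /\
    forall s, s \in G -> [/\ s \in S, nu s \in S, nu s != s /\ nu s != sg s,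
      close m s (nu s) & close m (sg s) (sg (nu s))].
Proof.
move=> nd mI sgP; have [S2|/nearest_exists-/(_ sg)[nu nuP]] := leqP #|S| 2.
  exists set0, id; split=> [|s]; last by rewrite inE.
  by apply: leq_trans (leq_mul S2 mI) _; rewrite cards0; lia.
pose r s := normsq (a s - a (nu s)).
pose D s := [set k | (normsq (a s - a k) <= r s)%R].
(* The parameters whose partner lies in the disc around [a s], with the denominator cleared; a
   parameter at the pole is excluded because it has no partner. *)
pose W s := [set k | (normsq (line_form l (a s) (a k)) <=
                      r s * normsq (l.1.2 + l.2 * a k))%R].
pose B1 := [set s in S | (m < #|D s|)%N].
pose B2 := [set s in S | (m < #|W s|)%N].
pose B3 := [set s in S | (normsq (l.1.2 + l.2 * a s) <= normsq l.2 * r s)%R].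
have overlap z : (#|[set s in S | (normsq (a s - z) <= r s)%R]| <= 17)%N.
  apply: (nearest_overlap (sg := sg)) => s s' sS s'S s's s'sg.
  by have [_ _ _] := nuP s sS; apply.
have B1m : (#|B1| * m <= 17 * #|I|)%N.
  apply: card_many_points => k; apply: leq_trans (overlap (a k)).
  by apply/subset_leq_card/subsetP => s; rewrite !inE.
have B2m : (#|B2| * m <= 17 * #|I|)%N.
  apply: card_many_points => k; pose w := a k.
  have [e|ne] := eqVneq (l.1.2 + l.2 * w) 0.
    rewrite (_ : [set s in S | _] = set0) ?cards0 //; apply/setP => s.
    rewrite !inE e /normsq /= expr0n addr0 mulr0; apply/negbTE.
    rewrite negb_and -ltNge -/(normsq _) normsq_gt0; apply/orP; right.
    apply: contraTneq nd => sw; rewrite negbK.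
    apply: contraTT (_ : l.1.2 + l.2 * w == 0) => [nd|]; last exact/eqP.
    by apply: (pole_not_partner (t := a s) nd); rewrite line_formC.
  apply: leq_trans (overlap (- (l.1.1 + l.1.2 * w) / (l.1.2 + l.2 * w))).
  apply/subset_leq_card/subsetP => s; rewrite !inE => /andP[-> /=].
  rewrite (@line_form_sub l (a s) (- (l.1.1 + l.1.2 * w) / (l.1.2 + l.2 * w))).
    by rewrite normsqM ler_pM2r // normsq_gt0.
  by rewrite /line_form -/w; field.
have B3m : (#|B3| * m <= 17 * #|I|)%N.
  apply: leq_mul => //; have [l20|l20] := eqVneq l.2 0.
    rewrite (_ : B3 = set0) ?cards0 //; apply/setP => s; rewrite !inE.
    rewrite l20 normsq0 !mul0r addr0 leNgt normsq_gt0.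
    by move: nd; rewrite /line_disc l20 mulr0 subr0 sqrf_eq0 => ->; rewrite andbF.
  apply: leq_trans (overlap (- l.1.2 / l.2)).
  apply/subset_leq_card/subsetP => s; rewrite !inE => /andP[-> /=].
  have -> : l.1.2 + l.2 * a s = l.2 * (a s - - l.1.2 / l.2) by field.
  by rewrite normsqM ler_pM2l // normsq_gt0.
exists (S :\: (B1 :|: B2 :|: B3)), nu; split.
  have sub : S \subset (S :\: (B1 :|: B2 :|: B3)) :|: (B1 :|: B2 :|: B3).
    by apply/subsetP => s sS; rewrite inE in_setD sS andbT orNb.
  have := subset_leq_card sub.
  have := (leq_card_setU (S :\: (B1 :|: B2 :|: B3)) (B1 :|: B2 :|: B3)).1.
  have := (leq_card_setU (B1 :|: B2) B3).1; have := (leq_card_setU B1 B2).1.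
  by nia.
move=> s; rewrite in_setD !inE => /andP[+ sS]; rewrite sS /= !negb_or.
rewrite -!leqNgt -ltNge => /andP[/andP[Dm Wm] pole].
have [nuS nus nusg _] := nuP s sS; split => //.
  split; first by rewrite eq_sym.
  exists ((- 2 * complex.Re (a s), - 2 * complex.Im (a s)), normsq (a s) - r s) => disc.
  have discE z : disc z = normsq (a s - z) - r s.
    by rewrite /disc /normsq; case: (a s) z => [x y] [u v] /=; ring.
  rewrite !discE subrr; split.
  - by rewrite normsq0 sub0r oppr_le0 normsq_ge0.
  - by rewrite subr_le0.
  - by apply: leq_trans Dm; apply/subset_leq_card/subsetP => k; rewrite !inE discE subr_le0.
split.
  apply: contra nus => /eqP e; apply/eqP/a_inj.
  apply: (@line_partner_uniq l (a (sg s))); rewrite // line_formC.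
    by rewrite e sgP.
  exact: sgP.
have [d dP] := line_disc_image pole; exists d => disc.
have discE k : (disc (a k) <= 0) = (k \in W s) by rewrite /disc dP inE.
rewrite !discE !inE; split.
- by rewrite sgP // normsq0 mulr_ge0 ?normsq_ge0.
- by rewrite (line_form_sub _ (sgP _ nuS)) normsqM.
- by apply: leq_trans Wm; apply/subset_leq_card/subsetP => k; rewrite inE discE.
Qed.

Lemma closeC m i j : close m i j -> close m j i.
Proof. by case=> ij [d [di dj dm]]; split; [rewrite eq_sym | exists d; split]. Qed.

(** Two points get equal abscissas for at most one value of [t]. *)
Lemma exists_injective_shear :
  exists t : R, injective (fun k => complex.Re (a k) - t * complex.Im (a k)).
Proof.
pose bad := [seq (complex.Re (a e.1) - complex.Re (a e.2)) /
    (complex.Im (a e.1) - complex.Im (a e.2)) | e <- enum {: I * I}].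
have [t tbad] := exists_natr_notin bad; exists t%:R => i j /eqP eqt; apply: a_inj.
have e : complex.Re (a i) - complex.Re (a j) = t%:R * (complex.Im (a i) - complex.Im (a j)).
  by apply/eqP; move: eqt; rewrite -subr_eq0 => /eqP h; rewrite -subr_eq0 -h; apply/eqP; ring.
have im : complex.Im (a i) = complex.Im (a j).
  apply/eqP; apply: contraR tbad; rewrite -subr_eq0 => ne; apply/mapP.
  by exists (i, j); rewrite ?mem_enum //= e mulfK.
by apply/eqP; rewrite eq_complex im eqxx andbT -subr_eq0 e im subrr mulr0.
Qed.

Lemma card_close m (E : {set I * I}) : (0 < m)%N ->
  (forall e, e \in E -> close m e.1 e.2) -> (#|E| <= 32 * m * #|I|)%N.
Proof.
move=> m0 EP; have [t X_inj] := exists_injective_shear.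
set X := fun k => _ in X_inj; pose Y k := complex.Im (a k).
have half (F : {set I * I}) : (forall e, e \in F -> close m e.1 e.2 /\ X e.1 < X e.2) ->
    (#|F| <= 16 * m * #|I|)%N.
  move=> FP; apply: (card_close_pairs (X := X) (Y := Y) (t := t)) => // e eF.
  have [[_ [[[p q] c] /= [di dj dm]]] lt] := FP e eF; split=> //.
  (* The real part is [X k + t * Y k], which turns the coefficient [q] into [p * t + q]. *)
  have dE k : lifted X Y t (p, p * t + q, c) k =
      normsq (a k) + p * complex.Re (a k) + q * complex.Im (a k) + c.
    by rewrite /lifted /X /Y /normsq /=; ring.
  exists (p, p * t + q, c); rewrite !dE; split => //.
  by apply: leq_trans dm; apply/subset_leq_card/subsetP => k; rewrite !inE dE.
pose E1 := [set e in E | X e.1 < X e.2].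
pose E2 := [set e | (e.2, e.1) \in E :\: E1].
have E1c : (#|E1| <= 16 * m * #|I|)%N.
  by apply: half => e; rewrite inE => /andP[/EP].
have E2c : (#|E2| <= 16 * m * #|I|)%N.
  apply: half => -[i j]; rewrite inE in_setD inE /= => /andP[+ ijE].
  have cl := EP _ ijE; rewrite ijE /= -leNgt le_eqVlt => /orP[/eqP/X_inj eqij|->].
    by have [/= + _] := cl; rewrite eqij eqxx.
  by split => //; apply: closeC.
have ED : (#|E :\: E1| <= #|E2|)%N.
  apply: (leq_card_injective_rel (r := fun e f => f = (e.2, e.1))) => [[i j] ijE|].
    by exists (j, i); rewrite // inE.
  by move=> [i j] [i' j'] _ _ _ -> [-> ->].
have -> : #|E| = (#|E1| + #|E :\: E1|)%N.
  rewrite -(cardsID E1 E); congr (_ + _)%N.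
  by apply: eq_card => e; rewrite !inE andbA andbb.
lia.
Qed.

End RichLines.

(** * Incidences between pairs and their polar lines *)

Section Incidences.
Variables (R : rcfType) (n : nat) (a : 'I_n -> R[i]) (M : 'M[R[i]]_3).
Local Notation C := R[i].
Hypotheses (a_inj : injective a) (Munit : M \in unitmx).

Definition pair_row (x y : C) : 'rV[C]_3 :=
  \row_(k < 3) [:: 1; x + y; x * y]`_k.

Definition pair_line (e : 'I_n * 'I_n) : C * C * C :=
  let v := pair_row (a e.1) (a e.2) *m M in (v 0 0, v 0 1, v 0 2%:R).

Lemma pair_row_inj (e e' : 'I_n * 'I_n) : (e.1 < e.2)%N -> (e'.1 < e'.2)%N ->
  pair_row (a e.1) (a e.2) = pair_row (a e'.1) (a e'.2) -> e = e'.
Proof.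
case: e e' => [i j] [i' j'] /= ij ij' /rowP eqr.
have := eqr 1; have := eqr 2%:R; rewrite !mxE /= => eqp eqs.
have : (a i - a i') * (a i - a j') = 0.
  transitivity (a i * ((a i + a j) - (a i' + a j')) - (a i * a j - a i' * a j')); first ring.
  by rewrite eqs eqp !subrr mulr0 subr0.
move/eqP; rewrite mulf_eq0 !subr_eq0 => /orP[] /eqP aa.
  by move: eqs; rewrite aa => /addrI/a_inj ->; rewrite (a_inj aa).
move: eqs; rewrite aa addrC => /addIr/a_inj eqj; move: ij.
by rewrite eqj (a_inj aa) ltnNge ltnW.
Qed.

(** [M] is invertible and each [pair_row] starts with 1, so proportional lines come from equal rows.
    Both lines are given as multiples of one [v], possibly by zero. *)
Lemma pair_line_inj (e e' : 'I_n * 'I_n) (v : C * C * C) (c c' : C) : (e.1 < e.2)%N -> (e'.1 < e'.2)%N ->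
  pair_line e = (c * v.1.1, c * v.1.2, c * v.2) ->
  pair_line e' = (c' * v.1.1, c' * v.1.2, c' * v.2) -> e = e'.
Proof.
move=> ee ee'; have lineE f d : pair_line f = (d * v.1.1, d * v.1.2, d * v.2) ->
    pair_row (a f.1) (a f.2) *m M = d *: \row_k [:: v.1.1; v.1.2; v.2]`_k.
  case=> h0 h1 h2; apply/rowP => k; rewrite [RHS]mxE [X in _ = _ * X]mxE.
  case: k => [[|[|[|//]]] klt]; rewrite -?h0 -?h1 -?h2;
    by congr (fun_of_matrix _ _ _); apply: val_inj.
move=> /lineE l /lineE l'.
have : (c' *: pair_row (a e.1) (a e.2) - c *: pair_row (a e'.1) (a e'.2)) *m M = 0.
  by rewrite mulmxBl -!scalemxAl l l' !scalerA mulrC subrr.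
move/(congr1 (mulmx^~ (invmx M))); rewrite mul0mx mulmxK // => /subr0_eq eqr.
have cc : c' = c by move/rowP/(_ 0): eqr; rewrite !mxE /= !mulr1.
have c0 : c != 0.
  apply/negP => /eqP c0; move: l; rewrite c0 scale0r => /(congr1 (mulmx^~ (invmx M))).
  rewrite mul0mx mulmxK // => /rowP/(_ 0); rewrite !mxE /= => /eqP.
  by rewrite oner_eq0.
by apply: pair_row_inj ee ee' _; apply: (scalerI c0); rewrite -{1}cc.
Qed.

Definition incident (e p : 'I_n * 'I_n) :=
  line_form (pair_line e) (a p.1) (a p.2) == 0.

(** The triple is the cross product of [(1, e1, e2)] and [(1, f1, f2)]: two distinct points
    determine their line. *)
Lemma common_line (l : C * C * C) s t s' t' :
  (s + t != s' + t') || (s * t != s' * t') ->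
  line_form l s t = 0 -> line_form l s' t' = 0 ->
  exists c, let: (e1, e2, f1, f2) := (s + t, s * t, s' + t', s' * t') in
    l = (c * (e1 * f2 - e2 * f1), c * (e2 - f2), c * (f1 - e1)).
Proof.
case: l => [[l0 l1] l2]; rewrite /line_form /=.
move: (s + t) (s * t) (s' + t') (s' * t') => e1 e2 f1 f2 ne l_e l_f.
have l0E : l0 = - (l1 * e1 + l2 * e2) by rewrite -[LHS]subr0 -l_e; ring.
have rel : l1 * (e1 - f1) = - (l2 * (e2 - f2)).
  by apply/eqP; rewrite -subr_eq0 -[X in _ == X](subrr 0) -{1}l_e -l_f; apply/eqP; ring.
have [eq1|ne1] := eqVneq e1 f1.
  move: ne; rewrite eq1 eqxx /= -subr_eq0 => ne2; exists (l1 / (e2 - f2)).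
  have l20 : l2 = 0.
    apply/eqP; move: rel; rewrite eq1 subrr mulr0 => /esym/eqP.
    by rewrite oppr_eq0 mulf_eq0 (negPf ne2) orbF.
  by rewrite l0E eq1 l20; congr (_, _, _); field.
rewrite -subr_eq0 in ne1; have ne1' : f1 - e1 != 0 by rewrite -opprB oppr_eq0.
exists (l2 / (f1 - e1)).
have l1E : l1 = l2 / (f1 - e1) * (e2 - f2).
  by apply: (mulIf ne1); rewrite rel; field.
by rewrite l0E; congr (_, _, _); [rewrite l1E; field | | field].
Qed.

(** The double point of a tangent determines it. So an incidence is known from its pair and from
    which entry of the pair is the double point. *)
Lemma card_degenerate_incidences :
  (#|[set f : ('I_n * 'I_n) * ('I_n * 'I_n) | [&& (f.1.1 < f.1.2)%N,
      incident f.1 f.2 & (line_disc (pair_line f.1) == 0)%R]]| <= 2 * n ^ 2)%N.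
Proof.
have <- : #|[set: 'I_n * 'I_n * bool]| = (2 * n ^ 2)%N.
  by rewrite cardsT !card_prod card_ord card_bool mulnC.
pose r (f : ('I_n * 'I_n) * ('I_n * 'I_n)) (c : 'I_n * 'I_n * bool) :=
  f.2 = (if c.2 then c.1 else (c.1.2, c.1.1)) /\
  (pair_line f.1).1.2 + (pair_line f.1).2 * a c.1.1 = 0.
apply: (leq_card_injective_rel (r := r)).
  move=> [e [k l]]; rewrite inE => /and3P[_ /eqP i /eqP d].
  have /eqP := degenerate_factor d i; rewrite mulf_eq0 => /orP[] /eqP s0.
    by exists (k, l, true); rewrite ?inE.
  by exists (l, k, false); rewrite ?inE.
have multiple e x y : incident e (x, y) \/ incident e (y, x) ->
    (pair_line e).1.2 + (pair_line e).2 * a x = 0 ->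
    pair_line e = ((pair_line e).2 * (a x ^+ 2), (pair_line e).2 * - a x, (pair_line e).2 * 1).
  move=> i s0; apply: degenerate_multiple (s0) (_ : line_form _ _ (a y) = 0).
  by case: i => /eqP //; rewrite line_formC.
move=> [e [k l]] [e' [k' l']] [[x y] b]; rewrite !inE /=.
move=> /and3P[ee i _] /and3P[ee' i' _] [/= kl s0] [/= kl' s0'].
rewrite kl kl' in i i' *.
have ei : incident e (x, y) \/ incident e (y, x) by move: i; case: (b); [left|right].
have ei' : incident e' (x, y) \/ incident e' (y, x) by move: i'; case: (b); [left|right].
by rewrite (pair_line_inj (v := (a x ^+ 2, - a x, 1)) ee ee' (multiple _ _ _ ei s0)
  (multiple _ _ _ ei' s0')).
Qed.

Lemma rich_pair_line m e : (m <= n)%N -> line_disc (pair_line e) != 0 ->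
  exists d : {set 'I_n} * ('I_n -> 'I_n) * ('I_n -> 'I_n),
    (#|[set p | incident e p]| * m <= #|d.1.1| * m + 51 * n)%N /\
    forall s, s \in d.1.1 ->
    [/\ incident e (s, d.2 s) /\ incident e (d.1.2 s, d.2 (d.1.2 s)),
        d.1.2 s != s /\ d.1.2 s != d.2 s,
        close a m s (d.1.2 s) & close a m (d.2 s) (d.2 (d.1.2 s))].
Proof.
move=> mn nd; pose S := [set k | [exists l, incident e (k, l)]].
pose sg k := odflt k [pick l | incident e (k, l)].
have sgP k : k \in S -> incident e (k, sg k).
  rewrite inE /sg => /existsP[l kl]; case: pickP => //= none.
  by move: (none l); rewrite kl.
have [|s sS|G [nu [cardG GP]]] := rich_line (m := m) (S := S) (sg := sg) a_inj nd.
- by rewrite card_ord.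
- exact/eqP/sgP.
exists (G, nu, sg); split=> [|s sG] /=; last first.
  by have [sS nuS [n1 n2] c1 c2] := GP s sG; split=> //; split; apply: sgP.
rewrite card_ord in cardG; apply: leq_trans cardG; rewrite leq_mul2r; apply/orP; right.
apply: (leq_card_injective_rel (r := fun p k => k = p.1)) => [[k l]|].
  by rewrite inE => i; exists k => //; rewrite inE; apply/existsP; exists l.
move=> [k l] [k' l'] s; rewrite !inE /incident => /eqP + /eqP + -> /= kk.
by rewrite -kk /= => h h'; rewrite (a_inj (line_partner_uniq nd h h')).
Qed.

(** An element [s] kept on the line of [e] is sent to the two close pairs [(s, nu s)] and
    [(sg s, sg (nu s))]. These contain two points of the line, hence determine [e], so at most
    [(32 * m * n) ^ 2] elements are kept in all. *)
Lemma card_nondegenerate_incidences m : (0 < m)%N -> (m <= n)%N ->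
  (#|[set f : ('I_n * 'I_n) * ('I_n * 'I_n) | [&& (f.1.1 < f.1.2)%N,
      incident f.1 f.2 & (line_disc (pair_line f.1) != 0)%R]]| * m
    <= (32 * m * n) ^ 2 * m + 51 * n ^ 3)%N.
Proof.
move=> m0 mn; set F := [set f | _].
pose L := [set e : 'I_n * 'I_n | (e.1 < e.2)%N && (line_disc (pair_line e) != 0)].
have /choice[d dP] : forall e, exists d : {set 'I_n} * ('I_n -> 'I_n) * ('I_n -> 'I_n),
    e \in L ->
    (#|[set p | incident e p]| * m <= #|d.1.1| * m + 51 * n)%N /\
    forall s, s \in d.1.1 ->
    [/\ incident e (s, d.2 s) /\ incident e (d.1.2 s, d.2 (d.1.2 s)),
        d.1.2 s != s /\ d.1.2 s != d.2 s,
        close a m s (d.1.2 s) & close a m (d.2 s) (d.2 (d.1.2 s))].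
  move=> e; have [|_] := boolP (e \in L); last by exists (set0, id, id).
  by rewrite inE => /andP[_ /(rich_pair_line mn)[d dP]]; exists d.
have FE : #|F| = (\sum_(e in L) #|[set p | incident e p]|)%N.
  have := double_counting L [set: 'I_n * 'I_n] incident.
  have setTE e : [set p in [set: 'I_n * 'I_n] | incident e p] = [set p | incident e p].
    by apply/setP => k; rewrite !inE.
  under eq_bigr => e _ do rewrite setTE.
  move=> _; under eq_bigr => e _ do rewrite -sum1_card.
  rewrite pair_big_dep /= -sum1_card; apply: eq_bigl => -[e p].
  by rewrite !inE /= -andbA; congr (_ && _); rewrite andbC.
pose Cl := [set e | `[< close a m e.1 e.2 >]].
have cardCl : (#|Cl| <= 32 * m * n)%N.
  by rewrite -[X in (_ * X)%N](card_ord n); apply: (card_close a_inj) => // e; rewrite inE => /asboolP.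
have cardG : (\sum_(e in L) #|(d e).1.1| <= (32 * m * n) ^ 2)%N.
  apply: leq_trans (_ : #|Cl| ^ 2 <= _)%N; last by rewrite leq_exp2r.
  pose G := [set p : ('I_n * 'I_n) * 'I_n | (p.1 \in L) && (p.2 \in (d p.1).1.1)].
  have -> : (\sum_(e in L) #|(d e).1.1| = #|G|)%N.
    under eq_bigr => e _ do rewrite -sum1_card.
    by rewrite pair_big_dep /= -sum1_card; apply: eq_bigl => -[e s]; rewrite [in RHS]inE.
  rewrite -mulnn -cardsX.
  apply: (leq_card_injective_rel (r := fun p q => let: (nu, sg) := ((d p.1).1.2, (d p.1).2) in
    q = ((p.2, nu p.2), (sg p.2, sg (nu p.2))))).
    move=> [e s]; rewrite inE /= => /andP[eL sG]; have [_ /(_ s sG)[_ _ c1 c2]] := dP e eL.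
    exists ((s, (d e).1.2 s), ((d e).2 s, (d e).2 ((d e).1.2 s))) => //.
    by rewrite !inE /=; apply/andP; split; apply/asboolP.
  move=> [e s] [e' s'] q; rewrite !inE /= => /andP[eL sG] /andP[eL' sG'] ->.
  move=> [ss nunu sgsg sn]; congr (_, _) => //.
  have eLm : e \in L by rewrite inE.
  have eLm' : e' \in L by rewrite inE.
  have [_ /(_ s sG)[[/eqP i1 /eqP i2] [n1 n2] _ _]] := dP e eLm.
  have [_ /(_ s' sG')[[/eqP i1' /eqP i2'] _ _ _]] := dP e' eLm'.
  rewrite /= -?sn -?nunu -?sgsg -?ss in i1' i2' i1 i2.
  move: eL eL' => /andP[ee _] /andP[ee' _].
  (* The two points differ since [nu s] is neither [s] nor [sg s]. *)
  have ne : (a s + a ((d e).2 s) != a ((d e).1.2 s) + a ((d e).2 ((d e).1.2 s))) ||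
      (a s * a ((d e).2 s) != a ((d e).1.2 s) * a ((d e).2 ((d e).1.2 s))).
    rewrite -negb_and; apply/negP => /andP[/eqP es /eqP ep].
    move: n1 n2 es ep; set nu := (d e).1.2 s; set t := (d e).2 s; set t' := (d e).2 nu.
    move=> n1 n2 es ep.
    have : (a s - a nu) * (a s - a t') = 0.
      transitivity (a s * ((a s + a t) - (a nu + a t')) - (a s * a t - a nu * a t')).
        by ring.
      by rewrite es ep !subrr mulr0 subr0.
    move/eqP; rewrite mulf_eq0 !subr_eq0 => /orP[] /eqP/a_inj sE.
      by rewrite sE eqxx in n1.
    by move: es; rewrite sE addrC => /addIr/a_inj tE; rewrite tE eqxx in n2.
  have [c l_c] := common_line ne i1 i2; have [c' l_c'] := common_line ne i1' i2'.
  pose v := ((a s + a ((d e).2 s)) * (a ((d e).1.2 s) * a ((d e).2 ((d e).1.2 s)))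
    - (a s * a ((d e).2 s)) * (a ((d e).1.2 s) + a ((d e).2 ((d e).1.2 s))),
    (a s * a ((d e).2 s)) - (a ((d e).1.2 s) * a ((d e).2 ((d e).1.2 s))),
    (a ((d e).1.2 s) + a ((d e).2 ((d e).1.2 s))) - (a s + a ((d e).2 s))).
  exact: (pair_line_inj (v := v) ee ee' l_c l_c').
rewrite FE big_distrl /=.
apply: leq_trans (_ : \sum_(e in L) (#|(d e).1.1| * m + 51 * n) <= _)%N.
  by apply: leq_sum => e /dP[].
rewrite big_split /= -big_distrl /= sum_nat_const.
have cardL : (#|L| <= n ^ 2)%N.
  by apply: leq_trans (max_card _) _; rewrite card_prod card_ord.
apply: leq_add; first by rewrite leq_mul2r cardG orbT.
by apply: leq_trans (leq_mul cardL (leqnn _)) _; apply: eq_leq; ring.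
Qed.

Lemma card_incidences m : (0 < m)%N -> (m <= n)%N ->
  (#|[set f : ('I_n * 'I_n) * ('I_n * 'I_n) | (f.1.1 < f.1.2)%N && incident f.1 f.2]| * m
    <= 1024 * n ^ 2 * m ^ 3 + 53 * n ^ 3)%N.
Proof.
move=> m0 mn; set F := [set f | _].
pose D := [set f in F | line_disc (pair_line f.1) == 0].
have -> : #|F| = (#|F :&: D| + #|F :\: D|)%N by rewrite cardsID.
have := card_nondegenerate_incidences m0 mn; have := card_degenerate_incidences.
set F1 := [set f | _]; set F2 := [set f | _] => c1 c2.
have -> : F :&: D = F1 by apply/setP => f; rewrite !inE; case: (f.1.1 < f.1.2)%N; case: (incident f.1 f.2).
have -> : F :\: D = F2.
  by apply/setP => f; rewrite !inE; case: (f.1.1 < f.1.2)%N; case: (incident f.1 f.2); rewrite ?andbF ?andbT.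
have c1' : (#|F1| * m <= 2 * n ^ 3)%N.
  by apply: leq_trans (leq_mul c1 mn) _; apply: eq_leq; ring.
rewrite mulnDl; apply: leq_trans (leq_add c1' c2) _.
by apply: eq_leq; ring.
Qed.
End Incidences.

(** * Apolarity and quadrics *)

Local Notation o4 k := (@Ordinal 4 k isT).
Local Notation o5 k := (@Ordinal 5 k isT).

Section Apolar.
Variable C : numClosedFieldType.
Implicit Types (u v a b : 'rV[C]_2) (U : 'I_4 -> 'rV[C]_2).

Definition bracket u v : C := u 0 0 * v 0 1 - u 0 1 * v 0 0.

Lemma big_ord4 (T : Type) (idx : T) (op : Monoid.law idx) (F : 'I_4 -> T) :
  \big[op/idx]_(j < 4) F j = op (op (op (F (o4 0)) (F (o4 1))) (F (o4 2))) (F (o4 3)).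
Proof.
rewrite !big_ord_recr big_ord0 /= Monoid.mul1m.
by do 3?congr (op _ _); congr F; apply: val_inj.
Qed.

(* The binary quartic [u |-> \prod_j bracket u (U j)], in the basis of
   [quartic_monomials]. *)
Definition quart U : 'cV[C]_5 :=
  let p j := U j 0 1 in let q j := - U j 0 0 in
  let: (p0, p1, p2, p3) := (p (o4 0), p (o4 1), p (o4 2), p (o4 3)) in
  let: (q0, q1, q2, q3) := (q (o4 0), q (o4 1), q (o4 2), q (o4 3)) in
  \col_(k < 5) [:: q0 * q1 * q2 * q3;
    p0 * q1 * q2 * q3 + q0 * p1 * q2 * q3 + q0 * q1 * p2 * q3 + q0 * q1 * q2 * p3;
    p0 * p1 * q2 * q3 + p0 * q1 * p2 * q3 + p0 * q1 * q2 * p3 +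
    q0 * p1 * p2 * q3 + q0 * p1 * q2 * p3 + q0 * q1 * p2 * p3;
    q0 * p1 * p2 * p3 + p0 * q1 * p2 * p3 + p0 * p1 * q2 * p3 + p0 * p1 * p2 * q3;
    p0 * p1 * p2 * p3]`_k.

Definition polar (c : 'rV[C]_5) U : C := (c *m quart U) 0 0.

Lemma polarD c d U : polar (c + d) U = polar c U + polar d U.
Proof. by rewrite /polar mulmxDl mxE. Qed.

Lemma polarZ k c U : polar (k *: c) U = k * polar c U.
Proof. by rewrite /polar -scalemxAl mxE. Qed.

Lemma big_ord5 (T : Type) (idx : T) (op : Monoid.law idx) (F : 'I_5 -> T) :
  \big[op/idx]_(j < 5) F j = op (op (op (op (F (o5 0)) (F (o5 1))) (F (o5 2))) (F (o5 3))) (F (o5 4)).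
Proof.
rewrite !big_ord_recr big_ord0 /= Monoid.mul1m.
by do 4?congr (op _ _); congr F; apply: val_inj.
Qed.

(** On the rational normal quartic the pairing evaluates the form with roots [U]. *)
Lemma polar_monomials u U :
  polar (quartic_monomials u) U = \prod_j bracket u (U j).
Proof.
rewrite /polar mxE big_ord5 big_ord4 !mxE /bracket /=.
by ring.
Qed.

Lemma bracketC u v : bracket u v = - bracket v u.
Proof. by rewrite /bracket; ring. Qed.

Lemma bracketxx u : bracket u u = 0.
Proof. by rewrite /bracket; ring. Qed.

(** The point [(k : 1)] is chosen away from all [V i], and can serve as the point at infinity. *)
Lemma exists_nonroot (I : finType) (V : I -> 'rV[C]_2) : (forall i, V i != 0) ->
  exists k : nat, forall i, V i 0 0 - k%:R * V i 0 1 != 0.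
Proof.
move=> V0; have [k kP] := exists_natr_notin [seq V i 0 0 / V i 0 1 | i <- enum I].
exists k => i; apply: contra kP; rewrite subr_eq0 => /eqP e.
apply/mapP; exists i; rewrite ?mem_enum // e mulfK //.
apply: contraNneq (V0 i) => v1; apply/eqP/rowP => j; rewrite mxE.
case: j => [[|[|//]] jlt]; last by rewrite -[RHS]v1; congr (V i _ _); apply: val_inj.
by transitivity (V i 0 0); [congr (V i _ _); apply: val_inj | rewrite e v1 mulr0].
Qed.

Lemma exists_bracket_neq0 (I : finType) (V : I -> 'rV[C]_2) : (forall i, V i != 0) ->
  exists u, forall i, bracket u (V i) != 0.
Proof.
move=> /exists_nonroot[k kP]; exists (\row_j [:: k%:R; 1]`_j) => i.
by rewrite /bracket !mxE /= mul1r -oppr_eq0 opprB.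
Qed.

Lemma left_null (m n : nat) (A : 'M[C]_(m, n)) : ~~ row_free A ->
  exists2 x : 'rV_m, x != 0 & x *m A = 0.
Proof.
rewrite -kermx_eq0 => A0; exists (nz_row (kermx A)); first by rewrite nz_row_eq0.
exact/sub_kermxP/nz_row_sub.
Qed.

Lemma row_freePn (m n : nat) (A : 'M[C]_(m, n)) (x : 'rV_m) :
  x != 0 -> x *m A = 0 -> ~~ row_free A.
Proof.
by move=> x0 xA; apply: contra x0 => /mulmx_free_eq0 <-; rewrite xA.
Qed.

Definition annihilates (c : 'rV[C]_5) (A : 'M[C]_(5, 4)) :=
  [/\ c != 0, c *m A = 0 & forall x : 'rV_5, x *m A = 0 -> exists l, x = l *: c].

Lemma annihilator_exists (A : 'M[C]_(5, 4)) : row_full A -> exists c, annihilates c A.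
Proof.
move=> /eqP rA; have [|c c0 cA] := @left_null _ _ A; first by rewrite /row_free rA.
exists c; split => // x xA; apply/sub_rVP.
have rK : \rank (kermx A) = 1 by rewrite mxrank_ker rA.
have cK : (c <= kermx A)%MS by apply/sub_kermxP.
apply: submx_trans (_ : kermx A <= c)%MS; first exact/sub_kermxP.
by rewrite -(geq_leqif (mxrank_leqif_sup cK)) rK lt0n mxrank_eq0.
Qed.

(** * Coplanarity of four points as apolarity *)

Section Coplanarity.
Variables (A : 'M[C]_(5, 4)) (c : 'rV[C]_5).
Hypothesis cA : annihilates c A.
Variables (U : 'I_4 -> 'rV[C]_2) (d : 'I_4 -> C).
Hypotheses (U0 : forall j, U j != 0) (d0 : forall j, d j != 0)
  (Udist : forall i j, i != j -> bracket (U i) (U j) != 0).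

Let V := \matrix_(k < 4) quartic_monomials (U k).

Lemma polar_root k : polar (quartic_monomials (U k)) U = 0.
Proof. by rewrite polar_monomials (bigD1 k) //= bracketxx mul0r. Qed.

Lemma mulmx_monomials (w : 'rV_4) : w *m V = \sum_k w 0 k *: quartic_monomials (U k).
Proof. by rewrite mulmx_sum_row; apply: eq_bigr => k _; rewrite rowK. Qed.

Lemma polar_sum (I : finType) (f : I -> 'rV[C]_5) W :
  polar (\sum_k f k) W = \sum_k polar (f k) W.
Proof. by rewrite /polar mulmx_suml summxE. Qed.

(** The quartic obtained by moving the root [U k] to [q] vanishes at the other three points but not
    at [U k], and thus isolates [w 0 k]. *)
Lemma monomials_free (w : 'rV_4) : w *m V = 0 -> w = 0.
Proof.
move=> wV; apply/rowP => k; rewrite [RHS]mxE.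
have [q qP] := exists_bracket_neq0 (V := fun _ : unit => U k) (fun _ => U0 k).
pose W j := if j == k then q else U j.
have : polar (w *m V) W = 0 by rewrite wV /polar mul0mx mxE.
rewrite mulmx_monomials polar_sum (bigD1 k) //= big1 => [|i ik]; last first.
  rewrite polarZ polar_monomials (bigD1 i) //= {1}/W (negPf ik) bracketxx.
  by rewrite mul0r mulr0.
rewrite addr0 polarZ polar_monomials => /eqP; rewrite mulf_eq0 => /orP[/eqP //|].
rewrite prodf_seq_eq0 => /hasP[j _ /=]; rewrite /W; case: (eqVneq j k) => [_|jk].
  by rewrite bracketC oppr_eq0 (negPf (qP tt)).
by rewrite (negPf (Udist _)) // eq_sym.
Qed.

Lemma quart_neq0 : quart U != 0.
Proof.
have [u uP] := exists_bracket_neq0 U0.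
have : polar (quartic_monomials u) U != 0 by rewrite polar_monomials prodf_seq_neq0; apply/allP => j _; rewrite uP.
by apply: contraNneq => e; rewrite /polar e mulmx0 mxE.
Qed.

(** A dependency of the four points is a combination of the rows of [V] in the left kernel of [A],
    that is, a multiple of [c], nonzero since [V] is free. Pairing it with [quart U], which kills
    [V], gives [polar c U = 0]. *)
Lemma coplanar_polar :
  (\rank (\matrix_k (d k *: qparam A (U k))) <= 3)%N = (polar c U == 0).
Proof.
have [c0 cA0 cker] := cA.
set P := \matrix_k _.
have PE w : w *m P = (\row_k (w 0 k * d k)) *m V *m A.
  rewrite mulmx_monomials mulmx_suml mulmx_sum_row; apply: eq_bigr => k _.
  by rewrite rowK mxE scalerA -scalemxAl.
have -> : (\rank P <= 3)%N = ~~ row_free P.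
  by rewrite /row_free; have := rank_leq_row P; lia.
apply/idP/eqP => [/left_null[w w0]|cU].
  rewrite PE => /cker[l wV].
  have l0 : l != 0.
    apply: contraNneq w0 => l0; move: wV; rewrite l0 scale0r => /monomials_free/rowP w0.
    apply/eqP/rowP => k; move: (w0 k); rewrite !mxE => /eqP.
    by rewrite mulf_eq0 (negPf (d0 k)) orbF => /eqP.
  apply: (mulfI l0); rewrite mulr0 -polarZ -wV mulmx_monomials polar_sum big1 // => k _.
  by rewrite polarZ polar_root mulr0.
(* Conversely, the nonzero [quart U] kills the four rows of [V] and [c], so this square matrix is
   singular. *)
have [x x0 xE] : exists2 x : 'rV_(4 + 1), x != 0 & x *m col_mx V c = 0.
  apply: left_null; rewrite row_free_unit; apply: contraNN quart_neq0 => inv.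
  rewrite -(mulKmx inv (quart U)) mul_col_mx.
  suff -> : col_mx (V *m quart U) (c *m quart U) = 0 by rewrite mulmx0.
  apply/colP => i; rewrite !mxE; case: splitP => k _.
    rewrite mxE; transitivity (polar (quartic_monomials (U k)) U); last exact: polar_root.
    by rewrite /polar -(rowK (fun k => quartic_monomials (U k)) k) -row_mul !mxE.
  by rewrite [k]ord1 -[RHS]cU.
move: xE; rewrite -(hsubmxK x) mul_row_col => xE.
pose w := \row_k (lsubmx x 0 k / d k).
have wE : \row_k (w 0 k * d k) = lsubmx x.
  by apply/rowP => k; rewrite !mxE divfK.
apply: (@row_freePn _ _ P w).
  apply: contraNneq x0 => w0; have l0 : lsubmx x = 0.
    by rewrite -wE w0; apply/rowP => k; rewrite !mxE mul0r.
  rewrite -(hsubmxK x) l0; move: xE; rewrite l0 mul0mx add0r => /eqP.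
  rewrite [rsubmx x]mx11_scalar mul_scalar_mx scaler_eq0 (negPf c0) orbF => /eqP ->.
  by rewrite raddf0 row_mx0.
rewrite PE wE; have -> : lsubmx x *m V = - (rsubmx x *m c).
  by apply/eqP; rewrite -addr_eq0 xE.
by rewrite mulNmx -mulmxA cA0 mulmx0 oppr0.
Qed.
End Coplanarity.

Lemma big_ord3 (T : Type) (idx : T) (op : Monoid.law idx) (F : 'I_3 -> T) :
  \big[op/idx]_(j < 3) F j =
  op (op (F (@Ordinal 3 0 isT)) (F (@Ordinal 3 1 isT))) (F (@Ordinal 3 2 isT)).
Proof.
rewrite !big_ord_recr big_ord0 /= Monoid.mul1m.
by do 2?congr (op _ _); congr F; apply: val_inj.
Qed.

(** * The catalecticant and its determinant *)

Definition entry (c : 'rV[C]_5) (k : nat) : C := c 0 (inord k).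

Lemma row5E c : c = \row_k [:: entry c 0; entry c 1; entry c 2; entry c 3; entry c 4]`_k.
Proof.
apply/rowP => -[[|[|[|[|[|//]]]]] klt]; rewrite mxE /entry;
  by congr (c _ _); apply: val_inj; rewrite /= inordK.
Qed.

(** The Hankel matrix of [c] up to signs and reversal, which come from the coefficients of
    [bracket u (U j)]. It is the form on Sym^2 obtained by splitting four roots into two pairs. *)
Definition catalecticant (c : 'rV[C]_5) : 'M[C]_3 :=
  \matrix_(i < 3, j < 3)
    [:: entry c 4; - entry c 3; entry c 2; - entry c 1; entry c 0]`_(i + j).

Definition sym2 u v : 'rV[C]_3 :=
  \row_k [:: u 0 1 * v 0 1; u 0 0 * v 0 1 + u 0 1 * v 0 0; u 0 0 * v 0 0]`_k.

Lemma polar_catalecticant c U : polar c U =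
  (sym2 (U (o4 0)) (U (o4 1)) *m catalecticant c *m (sym2 (U (o4 2)) (U (o4 3)))^T) 0 0.
Proof.
rewrite /polar {1}[c]row5E [LHS]mxE big_ord5 [RHS]mxE big_ord3 ![(_ *m catalecticant c) _ _]mxE.
rewrite !big_ord3 !mxE /=.
by ring.
Qed.

Definition hankel_det (c : 'rV[C]_5) : C :=
  entry c 0 * (entry c 2 * entry c 4 - entry c 3 ^+ 2)
  - entry c 1 * (entry c 1 * entry c 4 - entry c 2 * entry c 3)
  + entry c 2 * (entry c 1 * entry c 3 - entry c 2 ^+ 2).

Lemma det_catalecticant c : \det (catalecticant c) = hankel_det c.
Proof.
rewrite (expand_det_row _ ord0) big_ord3 /cofactor !(expand_det_row _ ord0).
rewrite !big_ord_recl !big_ord0 /cofactor !det_mx11 !mxE /hankel_det /=.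
by ring.
Qed.

Lemma catalecticant_unit c : (catalecticant c \in unitmx) = (hankel_det c != 0).
Proof. by rewrite unitmxE det_catalecticant unitfE. Qed.

(** A kernel vector of the Hankel matrix is a linear recurrence for the entries of [c]. *)
Definition recurrent (c : 'rV[C]_5) (h0 h1 h2 : C) :=
  [/\ entry c 0 * h0 + entry c 1 * h1 + entry c 2 * h2 = 0,
      entry c 1 * h0 + entry c 2 * h1 + entry c 3 * h2 = 0 &
      entry c 2 * h0 + entry c 3 * h1 + entry c 4 * h2 = 0].

Lemma hankel_det0 c : hankel_det c = 0 ->
  exists h0 h1 h2, recurrent c h0 h1 h2 /\ [|| h0 != 0, h1 != 0 | h2 != 0].
Proof.
move=> D0; have [|x x0 xM] := @left_null _ _ (catalecticant c).
  by rewrite row_free_unit catalecticant_unit D0 eqxx.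
exists (x 0 (inord 2)), (- x 0 (inord 1)), (x 0 (inord 0)).
have E k : (k < 3)%N -> x 0 (inord 0) * (catalecticant c) (inord 0) (inord k) +
  x 0 (inord 1) * (catalecticant c) (inord 1) (inord k) +
  x 0 (inord 2) * (catalecticant c) (inord 2) (inord k) = 0.
  move=> k3; move/rowP/(_ (inord k)): xM; rewrite [RHS]mxE => <-; rewrite [RHS]mxE big_ord3.
  by do 2?congr (_ + _); congr (x _ _ * catalecticant c _ _); apply: val_inj;
    rewrite /= inordK.
have := E 0 isT; have := E 1 isT; have := E 2 isT; rewrite !mxE !inordK //= => E2 E1 E0.
split.
  by split; [rewrite -[RHS]E2 | rewrite -[RHS](oppr0) -E1 | rewrite -[RHS]E0]; ring.
apply: contraNT x0; rewrite !negb_or !negbK oppr_eq0 => /and3P[/eqP x2 /eqP x1 /eqP x0'].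
apply/eqP/rowP => k; rewrite mxE.
case: k => [[|[|[|//]]] klt]; [rewrite -[RHS]x0' | rewrite -[RHS]x1 | rewrite -[RHS]x2];
  by congr (x _ _); apply: val_inj; rewrite /= inordK.
Qed.

(* With the Hankel matrix [H = (c_(i + j))] and the polarized adjugate [adj],
   the hypotheses say that [adj (H, K) = l *: J] for
   [K = [2p5, -p4, p3; -p4, 2p2, -p1; p3, -p1, 2p0]] and the antidiagonal
   matrix [J] of [1, -2, 1]; the conclusion is [\det H *: K = - l *: H *m J *m H],
   by [K *m adj H = \tr (K *m adj H) - H *m adj (H, K)]. *)
Lemma hankel_adjugate (c0 c1 c2 c3 c4 p0 p1 p2 p3 p4 p5 : C) :
  let D := c0 * (c2 * c4 - c3 ^+ 2) - c1 * (c1 * c4 - c2 * c3) + c2 * (c1 * c3 - c2 ^+ 2) in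
  c2 * p0 + c3 * p1 + c4 * p2 = 0 ->
  - 2 * c1 * p0 - c2 * p1 + c3 * p3 + c4 * p4 = 0 ->
  c0 * p0 - c1 * p1 - 2 * c2 * (p2 + p3) - c3 * p4 + c4 * p5 = 0 ->
  c0 * p1 + c1 * p3 - c2 * p4 - 2 * c3 * p5 = 0 ->
  c0 * p2 + c1 * p4 + c2 * p5 = 0 ->
  exists l, [/\ D * (2 * p5) = - l * (2 * c0 * c2 - 2 * c1 ^+ 2),
      D * - p4 = - l * (c0 * c3 - c1 * c2),
      D * p3 = - l * (c0 * c4 - 2 * c1 * c3 + c2 ^+ 2) &
      [/\ D * (2 * p2) = - l * (2 * c1 * c3 - 2 * c2 ^+ 2),
      D * - p1 = - l * (c1 * c4 - c2 * c3) &
      D * (2 * p0) = - l * (2 * c2 * c4 - 2 * c3 ^+ 2)]].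
Proof.
move=> D e0 e1 e2 e3 e4.
pose l := - c1 * p1 - p4 * c3 - 2 * c2 * p2 - c2 * p3.
pose j0 := c2 * p0 + c3 * p1 + c4 * p2.
pose j1 := - 2 * c1 * p0 - c2 * p1 + c3 * p3 + c4 * p4.
pose j2 := c0 * p0 - c1 * p1 - 2 * c2 * (p2 + p3) - c3 * p4 + c4 * p5.
pose j3 := c0 * p1 + c1 * p3 - c2 * p4 - 2 * c3 * p5.
pose j4 := c0 * p2 + c1 * p4 + c2 * p5.
pose t := c0 * j0 + c1 * j1 + c2 * j2 + c3 * j3 + c4 * j4.
(* The combination of the hypotheses by which the two sides of a conclusion differ: [x] and [y] are
   two rows of the Hankel matrix, and [h] is its entry at their indices. *)
pose r (x0 x1 x2 y0 y1 y2 h : C) := t * h - (2 * j0 * x0 * y0 + j1 * (x0 * y1 + x1 * y0) +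
  2 * j2 * x1 * y1 + j3 * (x1 * y2 + x2 * y1) + 2 * j4 * x2 * y2).
have r0 x0 x1 x2 y0 y1 y2 h : r x0 x1 x2 y0 y1 y2 h = 0.
  by rewrite /r /t /j0 /j1 /j2 /j3 /j4 e0 e1 e2 e3 e4; ring.
have fin X Y x0 x1 x2 y0 y1 y2 h : X - Y = r x0 x1 x2 y0 y1 y2 h -> X = Y.
  by rewrite r0 => /eqP; rewrite subr_eq0 => /eqP.
exists l; split; [| | |split].
- by apply: (fin _ _ c0 c1 c2 c0 c1 c2 c0); rewrite /r /t /j0 /j1 /j2 /j3 /j4 /D /l; ring.
- by apply: (fin _ _ c0 c1 c2 c1 c2 c3 c1); rewrite /r /t /j0 /j1 /j2 /j3 /j4 /D /l; ring.
- by apply: (fin _ _ c0 c1 c2 c2 c3 c4 c2); rewrite /r /t /j0 /j1 /j2 /j3 /j4 /D /l; ring.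
- by apply: (fin _ _ c1 c2 c3 c1 c2 c3 c2); rewrite /r /t /j0 /j1 /j2 /j3 /j4 /D /l; ring.
- by apply: (fin _ _ c1 c2 c3 c2 c3 c4 c3); rewrite /r /t /j0 /j1 /j2 /j3 /j4 /D /l; ring.
- by apply: (fin _ _ c2 c3 c4 c2 c3 c4 c4); rewrite /r /t /j0 /j1 /j2 /j3 /j4 /D /l; ring.
Qed.

Lemma poly_vanish (s : seq C) : (forall x, (Poly s).[x] = 0) -> forall k, s`_k = 0.
Proof.
move=> s0 k; suff s_0 : Poly s = 0 by rewrite -coef_Poly s_0 coef0.
apply/eqP; apply: contraT => nz.
have := max_poly_roots nz (rs := [seq k%:R | k <- iota 0 (size (Poly s))]).
rewrite size_map size_iota ltnn; apply.
  by apply/allP => _ /mapP[i _ ->]; rewrite rootE s0.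
by rewrite map_inj_uniq ?iota_uniq // => i j /eqP; rewrite eqr_nat => /eqP.
Qed.

Lemma natr_neq0 k : (k.+1%:R : C) != 0.
Proof. by rewrite pnatr_eq0. Qed.

(** * Quadrics containing the curve *)

Section Quadrics.
Variables (A : 'M[C]_(5, 4)) (c : 'rV[C]_5).
Hypothesis (cA : annihilates c A).

(** The pullback of [Q] to the rational normal quartic is a binary octic that vanishes identically.
    Its nine coefficients are the antidiagonal sums of the symmetric 5 x 5 matrix, which leaves six
    free entries. *)
Lemma quadric_coefficients (Q : 'M[C]_4) : Q^T = Q ->
  (forall u, u != 0 -> qform Q (qparam A u) = 0) ->
  exists p0 p1 p2 p3 p4 p5 : C,
    A *m Q *m A^T = \matrix_(i < 5, j < 5)
      (nth [::] [:: [:: 0; 0; p0; p1; p2];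
                    [:: 0; - 2 * p0; - p1; p3; p4];
                    [:: p0; - p1; - 2 * (p2 + p3); - p4; p5];
                    [:: p1; p3; - p4; - 2 * p5; 0];
                    [:: p2; p4; p5; 0; 0]] i)`_j.
Proof.
move=> Qsym van; set Z := A *m Q *m A^T; pose z (i j : nat) : C := Z (inord i) (inord j).
have ZT : Z^T = Z by rewrite /Z !trmx_mul trmxK Qsym mulmxA.
have zC i j : z i j = z j i by rewrite /z -{1}ZT mxE.
have zE i j (i5 : (i < 5)%N) (j5 : (j < 5)%N) : Z (Ordinal i5) (Ordinal j5) = z i j.
  by congr (Z _ _); apply: val_inj; rewrite /= inordK.
pose s := [:: z 0%N 0%N; 2 * z 0%N 1%N; 2 * z 0%N 2%N + z 1%N 1%N;
  2 * z 0%N 3%N + 2 * z 1%N 2%N; 2 * z 0%N 4%N + 2 * z 1%N 3%N + z 2%N 2%N; 2 * z 1%N 4%N + 2 * z 2%N 3%N;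
  2 * z 2%N 4%N + z 3%N 3%N; 2 * z 3%N 4%N; z 4%N 4%N].
have poly0 k : s`_k = 0.
  apply: poly_vanish => x; pose u : 'rV[C]_2 := \row_k [:: x; 1]`_k.
  have u0 : u != 0 by apply/negP => /eqP/rowP/(_ 1)/eqP; rewrite !mxE /= oner_eq0.
  rewrite horner_Poly -[RHS](van u u0) /qform /qparam trmx_mul !mulmxA -(mulmxA _ A) -(mulmxA _ (A *m Q)) -/Z.
  rewrite [RHS]mxE big_ord5 ![(_ *m Z) _ _]mxE !big_ord5 !zE !mxE /=.
  rewrite (zC 1%N 0%N) (zC 2%N 0%N) (zC 2%N 1%N) (zC 3%N 0%N) (zC 3%N 1%N) (zC 3%N 2%N).
  rewrite (zC 4%N 0%N) (zC 4%N 1%N) (zC 4%N 2%N) (zC 4%N 3%N); ring.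
have two0 : (2 : C) != 0 := natr_neq0 1.
have z00 : z 0%N 0%N = 0 := poly0 0%N.
have z01 : z 0%N 1%N = 0 by apply: (mulfI two0); rewrite mulr0; exact: poly0 1%N.
have z11 : z 1%N 1%N = - 2 * z 0%N 2%N.
  by apply/eqP; rewrite mulNr -addr_eq0 addrC; apply/eqP/(poly0 2%N).
have z12 : z 1%N 2%N = - z 0%N 3%N.
  apply/eqP; rewrite -addr_eq0 addrC; apply/eqP/(mulfI two0).
  by rewrite mulr0 mulrDr; exact: poly0 3%N.
have z22 : z 2%N 2%N = - 2 * (z 0%N 4%N + z 1%N 3%N).
  by apply/eqP; rewrite mulNr -addr_eq0 addrC mulrDr; apply/eqP/(poly0 4%N).
have z23 : z 2%N 3%N = - z 1%N 4%N.
  apply/eqP; rewrite -addr_eq0 addrC; apply/eqP/(mulfI two0).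
  by rewrite mulr0 mulrDr; exact: poly0 5%N.
have z33 : z 3%N 3%N = - 2 * z 2%N 4%N.
  by apply/eqP; rewrite mulNr -addr_eq0 addrC; apply/eqP/(poly0 6%N).
have z34 : z 3%N 4%N = 0 by apply: (mulfI two0); rewrite mulr0; exact: poly0 7%N.
have z44 : z 4%N 4%N = 0 := poly0 8%N.
exists (z 0%N 2%N), (z 0%N 3%N), (z 0%N 4%N), (z 1%N 3%N), (z 1%N 4%N), (z 2%N 4%N).
by apply/matrixP => -[[|[|[|[|[|//]]]]] i5] [[|[|[|[|[|//]]]]] j5];
  rewrite zE mxE //= zC.
Qed.

(* The conditions [c *m (A *m Q *m A^T) = 0]. *)
Lemma quadric_equations (Q : 'M[C]_4) (p0 p1 p2 p3 p4 p5 : C) :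
  A *m Q *m A^T = \matrix_(i < 5, j < 5)
      (nth [::] [:: [:: 0; 0; p0; p1; p2];
                    [:: 0; - 2 * p0; - p1; p3; p4];
                    [:: p0; - p1; - 2 * (p2 + p3); - p4; p5];
                    [:: p1; p3; - p4; - 2 * p5; 0];
                    [:: p2; p4; p5; 0; 0]] i)`_j ->
  let e := entry c in
  [/\ e 2%N * p0 + e 3%N * p1 + e 4%N * p2 = 0,
      - 2 * e 1%N * p0 - e 2%N * p1 + e 3%N * p3 + e 4%N * p4 = 0,
      e 0%N * p0 - e 1%N * p1 - 2 * e 2%N * (p2 + p3) - e 3%N * p4 + e 4%N * p5 = 0,
      e 0%N * p1 + e 1%N * p3 - e 2%N * p4 - 2 * e 3%N * p5 = 0 &
      e 0%N * p2 + e 1%N * p4 + e 2%N * p5 = 0].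
Proof.
move=> ZE e; have [_ cA0 _] := cA.
have : c *m (A *m Q *m A^T) = 0 by rewrite !mulmxA cA0 !mul0mx.
rewrite ZE [c]row5E -/e => /rowP col.
have E k k5 := col (@Ordinal 5 k k5).
have := E 0%N isT; rewrite !mxE big_ord5 !mxE /= => E0.
have := E 1%N isT; rewrite !mxE big_ord5 !mxE /= => E1.
have := E 2%N isT; rewrite !mxE big_ord5 !mxE /= => E2.
have := E 3%N isT; rewrite !mxE big_ord5 !mxE /= => E3.
have := E 4%N isT; rewrite !mxE big_ord5 !mxE /= => E4.
split; [rewrite -[RHS]E0 | rewrite -[RHS]E1 | rewrite -[RHS]E2 | rewrite -[RHS]E3 |
  rewrite -[RHS]E4]; by ring.
Qed.

Hypothesis A_full : row_full A.

(** If the determinant is nonzero, [hankel_adjugate] makes the pullbacks of both quadrics multiples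
    of one matrix. A quadric is determined by its pullback because [A] has full column rank, so the
    two would be proportional. *)
Lemma first_species_hankel (delta : 'rV[C]_4 -> Prop) :
  (forall u, u != 0 -> delta (qparam A u)) -> first_species delta -> hankel_det c = 0.
Proof.
move=> dA [Q1 [Q2 [[sym1 Q10 on1] [sym2 Q20 on2] indep]]].
apply/eqP; apply: contraT => D0.
have [p0 [p1 [p2 [p3 [p4 [p5 ZE1]]]]]] :=
  quadric_coefficients sym1 (fun u nz => on1 _ (dA u nz)).
have [q0 [q1 [q2 [q3 [q4 [q5 ZE2]]]]]] :=
  quadric_coefficients sym2 (fun u nz => on2 _ (dA u nz)).
have [B BA] := row_fullP A_full.
have inj Q : A *m Q *m A^T = 0 -> Q = 0.
  move=> Q0; have -> : Q = B *m (A *m Q *m A^T) *m B^T.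
    by rewrite !mulmxA BA mul1mx -mulmxA -trmx_mul BA trmx1 mulmx1.
  by rewrite Q0 mulmx0 mul0mx.
have [e0 e1 e2 e3 e4] := quadric_equations ZE1.
have [f0 f1 f2 f3 f4] := quadric_equations ZE2.
have [l [a0 a1 a2 [a3 a4 a5]]] := hankel_adjugate e0 e1 e2 e3 e4.
have [l' [b0 b1 b2 [b3 b4 b5]]] := hankel_adjugate f0 f1 f2 f3 f4.
rewrite -/(hankel_det c) in a0 a1 a2 a3 a4 a5 b0 b1 b2 b3 b4 b5.
have two0 : (2 : C) != 0 := natr_neq0 1.
have prop g x y : hankel_det c * x = - l * g -> hankel_det c * y = - l' * g -> l' * x = l * y.
  by move=> ex ey; apply: (mulfI D0); rewrite !(mulrCA (hankel_det c)) ex ey; ring.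
have propN g x y : hankel_det c * - x = - l * g -> hankel_det c * - y = - l' * g -> l' * x = l * y.
  by move=> ex ey; apply/oppr_inj; rewrite -!mulrN; apply: prop ex ey.
have prop2 g x y : hankel_det c * (2 * x) = - l * g -> hankel_det c * (2 * y) = - l' * g ->
    l' * x = l * y.
  by move=> ex ey; apply: (mulfI two0); rewrite !(mulrCA 2); apply: prop ex ey.
have h0 := prop2 _ _ _ a5 b5; have h1 := propN _ _ _ a4 b4; have h2 := prop2 _ _ _ a3 b3.
have h3 := prop _ _ _ a2 b2; have h4 := propN _ _ _ a1 b1; have h5 := prop2 _ _ _ a0 b0.
have QE : l' *: Q1 = l *: Q2.
  apply/subr0_eq/inj; rewrite mulmxBr mulmxBl -!scalemxAr -!scalemxAl ZE1 ZE2.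
  apply/matrixP => -[[|[|[|[|[|//]]]]] i5] [[|[|[|[|[|//]]]]] j5]; rewrite !mxE /=;
    first [ring | by rewrite ?mulrN ?h0 ?h1 ?h2 ?h3 ?h4 ?h5; ring |
      by rewrite !(mulrCA _ (- 2)) ?mulrDr ?h0 ?h2 ?h3 ?h5; ring].
have [l'0|l'0] := eqVneq l' 0.
  have K0 : l *: Q2 = 0 by rewrite -QE l'0 scale0r.
  move/eqP: K0; rewrite scaler_eq0 (negPf Q20) orbF => /eqP l0.
  have zero g x : hankel_det c * x = - l * g -> x = 0.
    by move=> ex; apply: (mulfI D0); rewrite ex l0 oppr0 mul0r mulr0.
  have zero2 g x : hankel_det c * (2 * x) = - l * g -> x = 0.
    by move=> /zero ex; apply: (mulfI two0); rewrite ex mulr0.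
  have zeroN g x : hankel_det c * - x = - l * g -> x = 0.
    by move=> /zero ex; rewrite -[x]opprK ex oppr0.
  move/eqP: Q10; case; apply: inj; rewrite ZE1 (zero2 _ _ a0) (zeroN _ _ a1) (zero _ _ a2).
  rewrite (zero2 _ _ a3) (zeroN _ _ a4) (zero2 _ _ a5).
  by apply/matrixP => -[[|[|[|[|[|//]]]]] i5] [[|[|[|[|[|//]]]]] j5];
    rewrite !mxE /= ?addr0 ?mulr0 ?oppr0.
have [l0|l0] := eqVneq l 0.
  by move/eqP: QE; rewrite l0 scale0r scaler_eq0 (negPf l'0) (negPf Q10).
by move/eqP: (indep (l' / l)); case; rewrite mulrC -scalerA QE scalerA mulVf // scale1r.
Qed.

(** By dimension, the columns of [A] span the whole hyperplane annihilated by [c]. *)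
Lemma column_span m (Y : 'M[C]_(5, m)) : c *m Y = 0 -> exists P, Y = A *m P.
Proof.
move=> cY; have [c0 cA0 _] := cA.
have AK : (A^T <= kermx c^T)%MS by apply/sub_kermxP; rewrite -trmx_mul cA0 trmx0.
have KA : (kermx c^T <= A^T)%MS.
  rewrite -(geq_leqif (mxrank_leqif_sup AK)) mxrank_ker !mxrank_tr (eqP A_full).
  by rewrite rank_rV c0.
have /submxP[B YB] : (Y^T <= A^T)%MS.
  by apply: submx_trans KA; apply/sub_kermxP; rewrite -trmx_mul cY trmx0.
by exists B^T; rewrite -[Y]trmxK YB trmx_mul trmxK.
Qed.

Definition sym_product (p q : 'cV[C]_4) : 'M[C]_4 := 2^-1 *: (p *m q^T + q *m p^T).

Lemma sym_product_sym p q : (sym_product p q)^T = sym_product p q.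
Proof. by rewrite linearZ /= linearD /= !trmx_mul !trmxK addrC. Qed.

Lemma qformB Q Q' (r : 'rV[C]_4) : qform (Q - Q') r = qform Q r - qform Q' r.
Proof. by rewrite /qform mulmxBr mulmxBl !mxE. Qed.

Lemma qformD Q Q' (r : 'rV[C]_4) : qform (Q + Q') r = qform Q r + qform Q' r.
Proof. by rewrite /qform mulmxDr mulmxDl !mxE. Qed.

Lemma qformZ k Q (r : 'rV[C]_4) : qform (k *: Q) r = k * qform Q r.
Proof. by rewrite /qform -scalemxAr -scalemxAl mxE. Qed.

Lemma qform_scale k Q (r : 'rV[C]_4) : qform Q (k *: r) = k ^+ 2 * qform Q r.
Proof. by rewrite /qform linearZ /= -scalemxAr -!scalemxAl scalerA mxE. Qed.

Lemma qform_product p q (r : 'rV[C]_4) :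
  qform (sym_product p q) r = (r *m p) 0 0 * (r *m q) 0 0.
Proof.
have prod (x y : 'cV[C]_4) : (r *m (x *m y^T) *m r^T) 0 0 = (r *m x) 0 0 * (r *m y) 0 0.
  rewrite mulmxA -mulmxA -trmx_mul mxE big_ord1 [X in _ * X]mxE //.
rewrite qformZ /qform mulmxDr mulmxDl mxE !prod (mulrC ((r *m q) 0 0)).
by field.
Qed.

(* If [H h = 0], projecting from the singular point of the curve gives the conic
   [z_i = x^i * h(x)], and the curve lies on the cone [z0 z2 = z1 ^ 2] and on
   [w * h(z) = w(z)], where [w] is a fourth coordinate. *)
Lemma second_species_hankel (delta : 'rV[C]_4 -> Prop) :
  (forall p, delta p -> param_curve A p) -> second_species delta -> hankel_det c != 0.
Proof.
move=> dA [Q [_ Q_uniq]]; apply/negP => /eqP/hankel_det0[h0 [h1 [h2 [[rec0 rec1 rec2] hN0]]]].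
(* The columns are the shifts of [h], that is, the forms [x^i * h(x)]. The recurrence says that [c]
   kills them, so they are linear forms on the curve. *)
pose Y : 'M[C]_(5, 3) := \matrix_(k < 5, i < 3)
  (nth [::] [:: [:: h0; 0; 0]; [:: h1; h0; 0]; [:: h2; h1; h0]; [:: 0; h2; h1];
                [:: 0; 0; h2]] k)`_i.
have [P YP] : exists P, Y = A *m P.
  apply: column_span; rewrite [c]row5E; apply/rowP => k; rewrite mxE big_ord5.
  by case: k => [[|[|[|//]]] klt]; rewrite !mxE /=;
    [rewrite -[RHS]rec0 | rewrite -[RHS]rec1 | rewrite -[RHS]rec2]; ring.
have [B YB] : exists B, Y^T *m B = 1%:M.
  apply/row_freeP; apply: contraT => /left_null[x x0 xY].
  pose z k := x 0 (inord k).
  have xE k k3 : x 0 (@Ordinal 3 k k3) = z k.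
    by congr (x _ _); apply: val_inj; rewrite /= inordK.
  have E k k5 : (x *m Y^T) 0 (@Ordinal 5 k k5) = 0 by rewrite xY mxE.
  have := E 0%N isT; rewrite mxE big_ord3 !mxE !xE /= ?mulr0 ?addr0 => E0.
  have := E 1%N isT; rewrite mxE big_ord3 !mxE !xE /= ?mulr0 ?addr0 => E1.
  have := E 2%N isT; rewrite mxE big_ord3 !mxE !xE /= => E2.
  have := E 3%N isT; rewrite mxE big_ord3 !mxE !xE /= ?mulr0 ?add0r => E3.
  have := E 4%N isT; rewrite mxE big_ord3 !mxE !xE /= ?mulr0 ?add0r => E4.
  have cancel (y h : C) : h != 0 -> y * h = 0 -> y = 0.
    by move=> hn0 /eqP; rewrite mulf_eq0 (negPf hn0) orbF => /eqP.
  have [z0 [z1 z2]] : z 0%N = 0 /\ z 1%N = 0 /\ z 2%N = 0.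
    have [h0z|h0n] := eqVneq h0 0; last first.
      have z0 := cancel _ _ h0n E0.
      rewrite z0 mul0r add0r in E1; have z1 := cancel _ _ h0n E1.
      by rewrite z0 z1 !mul0r !add0r in E2; have z2 := cancel _ _ h0n E2.
    have [h2z|h2n] := eqVneq h2 0; last first.
      have z2 := cancel _ _ h2n E4.
      rewrite z2 mul0r addr0 in E3; have z1 := cancel _ _ h2n E3.
      by rewrite z2 z1 !mul0r !addr0 in E2; have z0 := cancel _ _ h2n E2.
    have h1n : h1 != 0 by move: hN0; rewrite h0z h2z !eqxx /= orbF.
    rewrite h0z h2z ?mulr0 ?add0r ?addr0 in E1 E2 E3.
    by split; [|split]; apply: (cancel _ _ h1n).
  move: x0; rewrite (_ : x = 0) ?eqxx //; apply/rowP => -[[|[|[|//]]] klt];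
    by rewrite xE mxE.
(* [d] is the vertex of the cone, and [p3] below a fourth coordinate with value 1 at [d]. *)
have [d d0 dP] : exists2 d : 'rV_4, d != 0 & d *m P = 0.
  by apply: left_null; rewrite /row_free neq_ltn (leq_ltn_trans (rank_leq_col P)).
have /rV0Pn[k dk] := d0.
pose p3 : 'cV[C]_4 := (d 0 k)^-1 *: delta_mx k 0.
have dp3 : (d *m p3) 0 0 = 1.
  rewrite -scalemxAr mxE -colE mxE mulVf //.
pose w := A *m p3; pose p i := col i P; pose we i := w (inord i) 0.
pose i0 := @Ordinal 3 0 isT; pose i1 := @Ordinal 3 1 isT; pose i2 := @Ordinal 3 2 isT.
pose Q1 := sym_product (p i0) (p i2) - sym_product (p i1) (p i1).
pose Q2 := sym_product p3 (h0 *: p i0 + h1 *: p i1 + h2 *: p i2) -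
  (we 0%N *: sym_product (p i0) (p i0) + we 1%N *: sym_product (p i0) (p i1) +
   we 2%N *: sym_product (p i1) (p i1) + we 3%N *: sym_product (p i1) (p i2) +
   we 4%N *: sym_product (p i2) (p i2)).
have pE r i : (r *m p i) 0 0 = (r *m P) 0 i by rewrite /p colE mulmxA -colE mxE.
have hE (r : 'rV_4) : (r *m (h0 *: p i0 + h1 *: p i1 + h2 *: p i2)) 0 0 =
    h0 * (r *m P) 0 i0 + h1 * (r *m P) 0 i1 + h2 * (r *m P) 0 i2.
  by rewrite !mulmxDr -!scalemxAr ![fun_of_matrix (_ + _) _ _]mxE ![fun_of_matrix (_ *: _) _ _]mxE !pE.
have Q1E (r : 'rV_4) : qform Q1 r = (r *m P) 0 i0 * (r *m P) 0 i2 - (r *m P) 0 i1 ^+ 2.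
  by rewrite qformB !qform_product !pE.
have Q2E (r : 'rV_4) : qform Q2 r = (r *m p3) 0 0 *
    (h0 * (r *m P) 0 i0 + h1 * (r *m P) 0 i1 + h2 * (r *m P) 0 i2) -
    (we 0%N * (r *m P) 0 i0 ^+ 2 + we 1%N * ((r *m P) 0 i0 * (r *m P) 0 i1) +
     we 2%N * (r *m P) 0 i1 ^+ 2 + we 3%N * ((r *m P) 0 i1 * (r *m P) 0 i2) +
     we 4%N * (r *m P) 0 i2 ^+ 2).
  by rewrite !(qform_product, qformB, qformD, qformZ) hE !pE.
have trB (X Z : 'M[C]_4) : (X - Z)^T = X^T - Z^T by rewrite linearB.
have trD (X Z : 'M[C]_4) : (X + Z)^T = X^T + Z^T by rewrite linearD.
have trZ m (X : 'M[C]_4) : (m *: X)^T = m *: X^T by rewrite linearZ.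
have sym1 : Q1^T = Q1 by rewrite trB !sym_product_sym.
have sym2 : Q2^T = Q2 by rewrite trB !(sym_product_sym, trD, trZ).
have vanish Q' : (forall u, qform Q' (qparam A u) = 0) -> forall q, delta q -> qform Q' q = 0.
  by move=> Q'0 q /dA[u [_ [k' [_ ->]]]]; rewrite qform_scale Q'0 mulr0.
have curveP u : qparam A u *m P = quartic_monomials u *m Y by rewrite YP mulmxA.
have curve3 u : (qparam A u *m p3) 0 0 = we 0%N * u 0 1 ^+ 4 + we 1%N * (u 0 0 * u 0 1 ^+ 3) +
    we 2%N * (u 0 0 ^+ 2 * u 0 1 ^+ 2) + we 3%N * (u 0 0 ^+ 3 * u 0 1) + we 4%N * u 0 0 ^+ 4.
  have wE j j5 : w (@Ordinal 5 j j5) 0 = we j.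
    by congr (w _ _); apply: val_inj; rewrite /= inordK.
  by rewrite -mulmxA -/w mxE big_ord5 !wE !mxE /=; ring.
pose h u := h0 * u 0 1 ^+ 2 + h1 * (u 0 0 * u 0 1) + h2 * u 0 0 ^+ 2.
have z0 u : (quartic_monomials u *m Y) 0 i0 = u 0 1 ^+ 2 * h u.
  by rewrite mxE big_ord5 !mxE /= /h; ring.
have z1 u : (quartic_monomials u *m Y) 0 i1 = u 0 0 * u 0 1 * h u.
  by rewrite mxE big_ord5 !mxE /= /h; ring.
have z2 u : (quartic_monomials u *m Y) 0 i2 = u 0 0 ^+ 2 * h u.
  by rewrite mxE big_ord5 !mxE /= /h; ring.
have on1 : forall q, delta q -> qform Q1 q = 0.
  by apply: vanish => u; rewrite Q1E curveP z0 z1 z2; ring.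
have on2 : forall q, delta q -> qform Q2 q = 0.
  by apply: vanish => u; rewrite Q2E curveP z0 z1 z2 curve3 /h; ring.
have [r rP] : exists r : 'rV_3 -> 'rV_4, forall t, r t *m P = t.
  exists (fun t => t *m (B^T *m A)) => t.
  by rewrite -!mulmxA -YP -[B^T *m Y]trmxK trmx_mul trmxK YB trmx1 mulmx1.
(* Adding [d] to a point leaves [Q1] unchanged but changes [Q2] by [h(t)], so proportionality would
   force [h = 0]. *)
have not_multiple m : Q2 <> m *: Q1.
  move=> Q21; have ht (t : 'rV_3) : h0 * t 0 i0 + h1 * t 0 i1 + h2 * t 0 i2 = 0.
    have := congr1 (fun Z => qform Z (r t + d)) Q21; have := congr1 (fun Z => qform Z (r t)) Q21.
    rewrite /= !qformZ !Q2E !Q1E !mulmxDl dP rP addr0 => e1 e2.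
    have {e1}e2 := etrans e2 (esym e1).
    rewrite [fun_of_matrix (_ + _) _ _]mxE dp3 in e2.
    by move/eqP: e2; rewrite -subr_eq0 => /eqP e2; rewrite -[RHS]e2; ring.
  have hi i : (i < 3)%N -> (if i == 0%N then h0 else if i == 1%N then h1 else h2) = 0.
    have := ht (\row_k (k == i :> nat)%:R); rewrite !mxE /=.
    by case: i => [|[|[|i]]] //=; rewrite ?mulr1 ?mulr0 ?addr0 ?add0r.
  have [/= h0z h1z h2z] := And3 (hi 0%N isT) (hi 1%N isT) (hi 2%N isT).
  by move: hN0; rewrite h0z h1z h2z eqxx.
have Q10 : Q1 != 0.
  apply/eqP => Q10; have := Q1E (r (\row_k (k != 1%N :> nat)%:R)).
  rewrite rP Q10 /qform mulmx0 mul0mx !mxE /= => /eqP.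
  by rewrite mulr1 expr0n subr0 eq_sym oner_eq0.
have Q20 : Q2 != 0 by apply/eqP => Q20; apply: (@not_multiple 0); rewrite scale0r.
have [c1 Qc1] := Q_uniq _ (And3 sym1 Q10 on1).
have [c2 Qc2] := Q_uniq _ (And3 sym2 Q20 on2).
have c10 : c1 != 0 by apply: contraNneq Q10 => c10; rewrite Qc1 c10 scale0r.
by apply: (@not_multiple (c2 / c1)); rewrite Qc1 scalerA divfK.
Qed.

(** * Secants and tangents of the rational normal quartic *)

Definition tangent a b : 'rV[C]_5 := \row_(k < 5)
  [:: 4 * a 0 1 ^+ 3 * b 0 1;
      b 0 0 * a 0 1 ^+ 3 + 3 * a 0 0 * a 0 1 ^+ 2 * b 0 1;
      2 * a 0 0 * b 0 0 * a 0 1 ^+ 2 + 2 * a 0 0 ^+ 2 * a 0 1 * b 0 1;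
      3 * a 0 0 ^+ 2 * b 0 0 * a 0 1 + a 0 0 ^+ 3 * b 0 1;
      4 * a 0 0 ^+ 3 * b 0 0]`_k.

(** [tangent a b] is the derivative of [quartic_monomials] at [a] in direction [b]; this is the
    product rule. *)
Lemma polar_tangent a b U : polar (tangent a b) U =
  \sum_j bracket b (U j) * \prod_(i | i != j) bracket a (U i).
Proof.
under eq_bigr => j _ do rewrite big_mkcond big_ord4.
by rewrite big_ord4 /polar mxE big_ord5 !mxE /bracket /=; ring.
Qed.

(** [c] lies on a secant, so the projection from [c] glues [a] and [b]. *)
Definition nodal := exists a b al be, [/\ bracket a b != 0, al != 0, be != 0 &
  c = al *: quartic_monomials a + be *: quartic_monomials b].

Definition cuspidal := exists a b al be, [/\ bracket a b != 0, be != 0 &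
  c = al *: quartic_monomials a + be *: tangent a b].

Hypothesis A_base_free : forall u, u != 0 -> qparam A u != 0.

(** If [c] were on the rational normal quartic, its parameter would be a common zero of the four
    forms. *)
Lemma annihilator_not_monomials l u : u != 0 -> c != l *: quartic_monomials u.
Proof.
move=> u0; have [c0 cA0 _] := cA; apply/eqP => cu.
have l0 : l != 0 by apply: contraNneq c0 => l0; rewrite cu l0 scale0r.
move/eqP: cA0; rewrite cu -scalemxAl scaler_eq0 (negPf l0) /=.
by apply/negP; exact: A_base_free.
Qed.

Lemma bracket_neq0l a b : bracket a b != 0 -> a != 0.
Proof. by apply: contraNneq => ->; rewrite /bracket !mxE !mul0r subr0. Qed.

Lemma nodalI a b al be : bracket a b != 0 ->
  c = al *: quartic_monomials a + be *: quartic_monomials b -> nodal.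
Proof.
move=> ab cE; exists a, b, al, be; split => //.
  apply: contraTneq (annihilator_not_monomials be (u := b) _) => [al0|].
    by rewrite cE al0 scale0r add0r eqxx.
  by apply: (bracket_neq0l (b := a)); rewrite bracketC oppr_eq0.
apply: contraTneq (annihilator_not_monomials al (bracket_neq0l ab)) => be0.
by rewrite cE be0 scale0r addr0 eqxx.
Qed.

Lemma cuspidalI a b al be : bracket a b != 0 ->
  c = al *: quartic_monomials a + be *: tangent a b -> cuspidal.
Proof.
move=> ab cE; exists a, b, al, be; split => //.
apply: contraTneq (annihilator_not_monomials al (bracket_neq0l ab)) => be0.
by rewrite cE be0 scale0r addr0 eqxx.
Qed.

Definition point (x y : C) : 'rV[C]_2 := \row_k [:: x; y]`_k.

Lemma bracket_point x y z t : bracket (point x y) (point z t) = x * t - y * z.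
Proof. by rewrite /bracket !mxE. Qed.

Lemma eq_row5 (d : 'rV[C]_5) : [/\ entry c 0 = d 0 (o5 0), entry c 1 = d 0 (o5 1),
  entry c 2 = d 0 (o5 2), entry c 3 = d 0 (o5 3) & entry c 4 = d 0 (o5 4)] -> c = d.
Proof.
case=> e0 e1 e2 e3 e4; rewrite [c]row5E; apply/rowP.
by case=> [[|[|[|[|[|//]]]]] klt]; rewrite mxE /= ?e0 ?e1 ?e2 ?e3 ?e4;
  congr (d _ _); apply: val_inj.
Qed.

(** The recurrence is solved by its characteristic roots: two distinct roots give a secant, a double
    root gives a tangent. When the leading coefficients vanish, roots move to infinity, the point
    [(1 : 0)]. *)
Lemma normal_form h0 h1 h2 : recurrent c h0 h1 h2 -> [|| h0 != 0, h1 != 0 | h2 != 0] ->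
  nodal \/ cuspidal.
Proof.
move=> [r0 r1 r2] hN0.
have [h2z|h2n] := eqVneq h2 0; last first.
  pose s := sqrtC (h1 ^+ 2 - 4 * h0 * h2).
  pose x := (- h1 + s) / (2 * h2); pose y := (- h1 - s) / (2 * h2).
  have h1E : h1 = - h2 * (x + y) by rewrite /x /y; field.
  have h0E : h0 = h2 * (x * y).
    transitivity ((h1 ^+ 2 - s ^+ 2) / (4 * h2)); first by rewrite sqrtCK; field.
    by rewrite /x /y; field.
  have rec p q r : p * h0 + q * h1 + r * h2 = 0 -> r = (x + y) * q - x * y * p.
    by rewrite h1E h0E => e; apply: (mulfI h2n); apply/eqP; rewrite -subr_eq0 -e; apply/eqP; ring.
  have [e2 e3 e4] := And3 (rec _ _ _ r0) (rec _ _ _ r1) (rec _ _ _ r2).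
  have [xy|xy] := eqVneq x y.
    right; apply: (@cuspidalI (point x 1) (point 1 0) (entry c 0) (entry c 1 - x * entry c 0)).
      by rewrite bracket_point mulr0 mulr1 sub0r oppr_eq0 oner_eq0.
    by apply: eq_row5; split; rewrite ?e4 ?e3 ?e2 -?xy !mxE /=; ring.
  rewrite -subr_eq0 in xy.
  left; apply: (@nodalI (point x 1) (point y 1) ((entry c 1 - y * entry c 0) / (x - y))
    ((x * entry c 0 - entry c 1) / (x - y))).
    by rewrite bracket_point mulr1 mul1r.
  by apply: eq_row5; split; rewrite ?e4 ?e3 ?e2 !mxE /=; field.
move: r0 r1 r2; rewrite h2z !mulr0 !addr0.
have [h1z|h1n] := eqVneq h1 0; last first.
  pose x := - h0 / h1; have rec p q : p * h0 + q * h1 = 0 -> q = x * p.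
    move=> e; apply: (mulfI h1n); apply/eqP; rewrite -subr_eq0 -e; apply/eqP.
    by rewrite /x; field.
  move=> /rec e1 /rec e2 /rec e3; left.
  apply: (@nodalI (point x 1) (point 1 0) (entry c 0) (entry c 4 - x ^+ 4 * entry c 0)).
    by rewrite bracket_point mulr0 mulr1 sub0r oppr_eq0 oner_eq0.
  by apply: eq_row5; split; rewrite ?e3 ?e2 ?e1 !mxE /=; ring.
have h0n : h0 != 0 by move: hN0; rewrite h1z h2z eqxx /= orbF.
rewrite h1z !mulr0 !addr0; have rec p : p * h0 = 0 -> p = 0.
  by move/eqP; rewrite mulf_eq0 (negPf h0n) orbF => /eqP.
move=> /rec e0 /rec e1 /rec e2; right.
apply: (@cuspidalI (point 1 0) (point 0 1) (entry c 4) (entry c 3)).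
  by rewrite bracket_point mulr1 mul0r subr0 oner_eq0.
by apply: eq_row5; split; rewrite ?e0 ?e1 ?e2 !mxE /=; ring.
Qed.

Definition arithmetic (T : nat) (U : nat -> 'rV[C]_2) :=
  (forall i j, i != j -> bracket (U i) (U j) != 0) /\
  (forall f : 'I_4 -> nat, (polar c (fun j => U (f j)) == 0) = (\sum_j f j == T)%N).

(** On [a - y *: b] the form is [bracket a b ^+ 4 * (al * y1 * y2 * y3 * y4 + be)]. A geometric
    progression turns products into sums of indices, and [mu] fixes the target sum [T]. *)
Lemma nodal_arithmetic T : nodal -> exists U : nat -> 'rV[C]_2, arithmetic T U.
Proof.
move=> [a [b [al [be [ab al0 be0 cE]]]]].
pose mu := 4.-root (- be / al / 2 ^+ T); pose y i := mu * 2 ^+ i.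
have two0 k : (2 ^+ k : C) != 0 by rewrite expf_neq0 ?natr_neq0.
have muE : mu ^+ 4 = - be / al / 2 ^+ T by rewrite rootCK.
have mu0 : mu != 0.
  apply/negP => /eqP muz; move/eqP: muE; rewrite muz expr0n eq_sym /=; apply/negP.
  by rewrite !mulf_neq0 ?invr_neq0 ?oppr_eq0.
have pow_inj i j : (2 ^+ i == 2 ^+ j :> C) = (i == j).
  by rewrite -!natrX eqr_nat eqn_exp2l.
exists (fun i => a - y i *: b); split.
  move=> i j ij; have -> : bracket (a - y i *: b) (a - y j *: b) = (y i - y j) * bracket a b.
    by rewrite /bracket !mxE; ring.
  by rewrite mulf_neq0 // -mulrBr mulf_neq0 // subr_eq0 pow_inj.
move=> f; rewrite cE polarD !polarZ !polar_monomials.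
have aU i : bracket a (a - y i *: b) = - y i * bracket a b by rewrite /bracket !mxE; ring.
have bU i : bracket b (a - y i *: b) = - bracket a b by rewrite /bracket !mxE; ring.
rewrite !big_ord4 /= !aU !bU.
have -> : al * (- y (f (o4 0)) * bracket a b * (- y (f (o4 1)) * bracket a b) *
    (- y (f (o4 2)) * bracket a b) * (- y (f (o4 3)) * bracket a b)) +
  be * (- bracket a b * - bracket a b * - bracket a b * - bracket a b) =
  bracket a b ^+ 4 * (al * mu ^+ 4) *
    (2 ^+ (f (o4 0) + f (o4 1) + f (o4 2) + f (o4 3)) - 2 ^+ T).
  have -> : be = - (al * mu ^+ 4 * 2 ^+ T) by rewrite muE; field; rewrite al0 two0.
  by rewrite /y !exprD; move: (2 ^+ f _) (2 ^+ f _) (2 ^+ f _) (2 ^+ f _) (2 ^+ T) => *; ring.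
rewrite mulf_eq0 subr_eq0 pow_inj.
by rewrite (negPf (mulf_neq0 (expf_neq0 _ ab) (mulf_neq0 al0 (expf_neq0 _ mu0)))).
Qed.

(** On [b - y *: a] the form is [bracket a b ^+ 4 * (al + be * (y1 + y2 + y3 + y4))]; the offset
    [mu] moves the target sum to [T]. *)
Lemma cuspidal_arithmetic T : cuspidal -> exists U : nat -> 'rV[C]_2, arithmetic T U.
Proof.
move=> [a [b [al [be [ab be0 cE]]]]].
pose mu := (- al / be - T%:R) / 4; pose y i := mu + i%:R.
exists (fun i => b - y i *: a); split.
  move=> i j ij; have -> : bracket (b - y i *: a) (b - y j *: a) = (y j - y i) * bracket a b.
    by rewrite /bracket !mxE; ring.
  by rewrite mulf_neq0 // subr_eq0 /y (inj_eq (addrI _)) eqr_nat eq_sym.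
move=> f; rewrite cE polarD !polarZ polar_monomials polar_tangent.
have aU i : bracket a (b - y i *: a) = bracket a b by rewrite /bracket !mxE; ring.
have bU i : bracket b (b - y i *: a) = y i * bracket a b by rewrite /bracket !mxE; ring.
under [X in _ + _ * X]eq_bigr => j _ do rewrite big_mkcond big_ord4.
rewrite !big_ord4 /= !aU !bU -[RHS](eqr_nat C) -[RHS]subr_eq0.
have cancel (p q r : C) : r != 0 -> p = r * q -> (p == 0) = (q == 0).
  by move=> r0 ->; rewrite mulf_eq0 (negPf r0).
apply: (cancel _ _ (be * bracket a b ^+ 4)); first by rewrite mulf_neq0 ?expf_neq0.
by rewrite /y /mu !natrD; field.
Qed.

(** If the images agree, a combination of the two monomial rows is [l *: c]. A quartic with roots
    [U i], [U j] and twice [U T.+1] kills the combination but not [c], as its indices sum to more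
    than [T]; hence [l = 0]. The fourth power with root [U j] then gives a contradiction. *)
Lemma arithmetic_inj T (U : nat -> 'rV[C]_2) i j : arithmetic T U -> i != j ->
  ~ proj_eq (qparam A (U i)) (qparam A (U j)).
Proof.
move=> [U_neq UT] ij [k [_ Uij]]; have [_ _ cker] := cA.
have [|l xl] := cker (quartic_monomials (U i) - k *: quartic_monomials (U j)).
  by rewrite mulmxBl -scalemxAl -/(qparam A (U i)) Uij subrr.
have polarB W : polar (quartic_monomials (U i) - k *: quartic_monomials (U j)) W =
    \prod_s bracket (U i) (W s) - k * \prod_s bracket (U j) (W s).
  by rewrite -scaleNr polarD polarZ !polar_monomials mulNr.
pose f (s : 'I_4) := nth 0%N [:: i; j; T.+1; T.+1] s.
have l0 : l = 0.
  have := polarB (fun s => U (f s)); rewrite xl polarZ !big_ord4 /= !bracketxx.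
  rewrite !(mul0r, mulr0) subrr => /eqP; rewrite mulf_eq0 UT big_ord4 /=.
  by case/orP => /eqP //; rewrite /f /=; clear; lia.
have := polarB (fun=> U j); rewrite xl l0 scale0r /polar mul0mx mxE !big_ord4 /= !bracketxx.
rewrite !mul0r mulr0 subr0 => /esym/eqP; rewrite !mulf_eq0 !orbb.
by rewrite (negPf (U_neq _ _ ij)).
Qed.

End Quadrics.

End Apolar.

(** * Counting quadruples *)

Definition increasing (n : nat) (f : {ffun 'I_4 -> 'I_n}) :=
  [forall i : 'I_4, forall j : 'I_4, (i < j)%N ==> (f i < f j)%N].

Lemma increasingP n (f : {ffun 'I_4 -> 'I_n}) :
  reflect (forall i j : 'I_4, (i < j)%N -> (f i < f j)%N) (increasing f).
Proof.
apply: (iffP forallP) => [incr i j ij|incr i]; first by have /forallP/(_ j)/implyP := incr i; exact.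
by apply/forallP => j; apply/implyP/incr.
Qed.

Lemma increasing_neq n (f : {ffun 'I_4 -> 'I_n}) i j : increasing f -> i != j -> f i != f j.
Proof.
move=> /increasingP incr; rewrite neq_ltn => /orP[] /incr lt; last rewrite eq_sym.
  by rewrite -val_eqE neq_ltn lt.
by rewrite -val_eqE neq_ltn lt.
Qed.

Lemma ffun4P n (f g : {ffun 'I_4 -> 'I_n}) :
  [/\ f (o4 0) = g (o4 0), f (o4 1) = g (o4 1), f (o4 2) = g (o4 2) & f (o4 3) = g (o4 3)] ->
  f = g.
Proof.
case=> e0 e1 e2 e3; apply/ffunP => -[[|[|[|[|//]]]] klt];
  by rewrite (bool_irrelevance klt isT).
Qed.

(** * Increasing quadruples with a given sum *)

Section Sums.
Variables (n T : nat).

Definition sum_quadruples : {set {ffun 'I_4 -> 'I_n}} :=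
  [set f : {ffun 'I_4 -> 'I_n} | increasing f && (\sum_j (f j : nat) == T)%N].

Lemma card_sum_quadruples_le : (#|sum_quadruples| <= n ^ 3)%N.
Proof.
have -> : (n ^ 3 = #|[set: 'I_n * 'I_n * 'I_n]|)%N.
  by rewrite cardsT !card_prod card_ord; lia.
apply: (leq_card_injective_rel (r := fun (f : {ffun 'I_4 -> 'I_n}) c => c = (f (o4 0), f (o4 1), f (o4 2)))).
  by move=> f _; eexists; rewrite ?inE.
move=> f g h; rewrite !inE !big_ord4 => /andP[_ /eqP sf] /andP[_ /eqP sg] -> [e0 e1 e2].
apply: ffun4P; split=> //; apply: val_inj.
by move: sf sg; rewrite /= e0 e1 e2 => <- /addnI.
Qed.

(** Three indices are free in the consecutive windows of length [m] from 0, [m] and [2 * m]. The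
    fourth, [6 * m - i - j - k], exceeds [3 * m] and is at most [6 * m]. *)
Lemma card_sum_quadruples_ge m : T = (9 * m)%N -> (7 * m < n)%N ->
  (m ^ 3 <= #|sum_quadruples|)%N.
Proof.
move=> TE mn; have -> : (m ^ 3 = #|[set: 'I_m * 'I_m * 'I_m]|)%N.
  by rewrite cardsT !card_prod card_ord; lia.
have n0 : (0 < n)%N by lia.
pose I0 := Ordinal n0; pose idx (k : nat) : 'I_n := insubd I0 k.
have idxE k : (k < n)%N -> idx k = k :> nat by move=> kn; rewrite val_insubd kn.
apply: (leq_card_injective_rel (r := fun (c : 'I_m * 'I_m * 'I_m) (f : {ffun 'I_4 -> 'I_n}) =>
  [/\ f (o4 0) = c.1.1 :> nat, f (o4 1) = (m + c.1.2)%N :> nat &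
      f (o4 2) = (2 * m + c.2)%N :> nat])).
  move=> [[i j] k] _; have [im jm km] := And3 (ltn_ord i) (ltn_ord j) (ltn_ord k).
  pose s := [:: i : nat; m + j; 2 * m + k; 6 * m - i - j - k]%N.
  pose f := [ffun q : 'I_4 => idx (nth 0%N s q)].
  have fE q : f q = nth 0%N s q :> nat.
    by rewrite ffunE idxE //; case: q => [[|[|[|[|//]]]] qlt] /=; lia.
  exists f; last by rewrite !fE.
  rewrite inE; apply/andP; split; last first.
    by rewrite big_ord4 !fE /=; apply/eqP; lia.
  apply/increasingP => p q; rewrite !fE.
  by case: p q => [[|[|[|[|//]]]] plt] [[|[|[|[|//]]]] qlt] //= _; lia.
move=> [[i j] k] [[i' j'] k'] f _ _ /= [e0 e1 e2] [e0' e1' e2'].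
by congr (_, _, _); apply: val_inj => /=; lia.
Qed.
End Sums.

(** * Quartics of the first species *)

Section FirstSpecies.
Variable C : numClosedFieldType.

Lemma first_species_count (delta : 'rV[C]_4 -> Prop) :
  rational_space_quartic delta -> first_species delta ->
  exists c1 c2 N : nat, forall n : nat, (N <= n)%N ->
    exists P : 'I_n -> 'rV[C]_4,
      [/\ points_on delta P, (n ^ 3 <= c1 * coplanar_quadruples P)%N &
          (coplanar_quadruples P <= c2 * n ^ 3)%N].
Proof.
move=> [A [[A_full A_free _] dA]] first.
have [c cA] := annihilator_exists A_full.
have onA u : u != 0 -> delta (qparam A u).
  by move=> u0; apply/dA; exists u; split=> //; exists 1; rewrite oner_eq0 scale1r.
have [h0 [h1 [h2 [rec hN0]]]] := hankel_det0 (first_species_hankel cA A_full onA first).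
(* For [n >= 8], [m = n %/ 8] satisfies [7 * m < n <= 16 * m], and 4096 is the cube of 16. *)
exists 4096%N, 1%N, 8%N => n n8; pose m := (n %/ 8)%N; pose T := (9 * m)%N.
have [U UT] : exists U : nat -> 'rV[C]_2, arithmetic c T U.
  case: (normal_form cA A_free rec hN0); [exact: nodal_arithmetic | exact: cuspidal_arithmetic].
have [U_neq Usum] := UT.
have U0 i : U i != 0 by apply: (bracket_neq0l (U_neq i i.+1 _)); lia.
pose P (i : 'I_n) := qparam A (U i); exists P.
have cardE : coplanar_quadruples P = #|sum_quadruples n T|.
  apply: eq_card => f; rewrite !inE -/(increasing f).
  have [incr|//] := boolP (increasing f); rewrite /= -Usum.
  rewrite -(coplanar_polar cA (U := fun j => U (f j)) (d := fun=> 1)) //.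
  - by congr (\rank _ <= 3)%N; apply/matrixP => k l; rewrite !mxE mul1r.
  - by move=> _; rewrite oner_eq0.
  - by move=> i j ij; apply: U_neq; apply: increasing_neq.
split.
- split=> [i|i j ij]; first exact: onA.
  exact (arithmetic_inj cA UT ij).
- have := card_sum_quadruples_ge (n := n) (erefl T) (m := m).
  rewrite cardE => ge; apply: leq_trans (_ : 4096 * m ^ 3 <= _)%N.
    have le : (n <= 16 * m)%N by lia.
    by apply: leq_trans (_ : (16 * m) ^ 3 <= _)%N; rewrite ?leq_exp2r // expnMn.
  by rewrite leq_mul2l ge //; lia.
- by rewrite cardE mul1n; apply: card_sum_quadruples_le.
Qed.
End FirstSpecies.

(** * Quartics of the second species *)

Section SecondSpecies.
Variable R : rcfType.
Local Notation C := R[i].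

Lemma bracket_eq0 (u v : 'rV[C]_2) : u != 0 -> v != 0 -> bracket u v = 0 ->
  exists2 l, l != 0 & u = l *: v.
Proof.
move=> u0 v0 uv.
have uE (w : 'rV[C]_2) : w = point (w 0 0) (w 0 1).
  by apply/rowP => -[[|[|//]] klt]; rewrite mxE; congr (w _ _); apply: val_inj.
have e : u 0 0 * v 0 1 = u 0 1 * v 0 0 by apply/eqP; rewrite -subr_eq0 -/(bracket u v) uv.
suff [l ul] : exists l, u = l *: v.
  by exists l => //; apply: contraNneq u0 => l0; rewrite ul l0 scale0r.
have [v1|v1] := eqVneq (v 0 1) 0.
  have v00 : v 0 0 != 0.
    by apply: contraNneq v0 => v00; rewrite [v]uE v00 v1; apply/eqP/rowP => -[[|[|//]] klt]; rewrite !mxE.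
  exists (u 0 0 / v 0 0); rewrite [LHS]uE [v in RHS]uE.
  have u1 : u 0 1 = 0 by apply: (mulIf v00); rewrite -e v1 mulr0 mul0r.
  by apply/rowP => -[[|[|//]] klt]; rewrite !mxE /= ?divfK // u1 v1 mulr0.
exists (u 0 1 / v 0 1); rewrite [LHS]uE [v in RHS]uE.
apply/rowP => -[[|[|//]] klt]; rewrite !mxE /= ?divfK //.
by apply: (mulIf v1); rewrite e; field.
Qed.

Lemma qparam_scale (A : 'M[C]_(5, 4)) l u : qparam A (l *: u) = l ^+ 4 *: qparam A u.
Proof.
rewrite /qparam scalemxAl; congr (_ *m _); apply/rowP => k; rewrite !mxE.
rewrite !exprMn mulrACA -exprD subnKC //; by have := ltn_ord k.
Qed.

Lemma sym2_scale (d e : C) u v : sym2 (d *: u) (e *: v) = (d * e) *: sym2 u v.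
Proof. by apply/rowP => -[[|[|[|//]]] klt]; rewrite !mxE /=; ring. Qed.

(** Change of basis from [(1, x + y, x * y)] to [sym2], for the affine coordinate [x] on the
    projective line whose point at infinity is [(k : 1)]. *)
Definition shear_mx (k : C) : 'M[C]_3 := \matrix_(i < 3, j < 3)
  (nth [::] [:: [:: 0; 0; 1]; [:: 0; 1; k]; [:: 1; 2 * k; k ^+ 2]] i)`_j.

Lemma sym2_point k x y :
  sym2 (point (1 + k * x) x) (point (1 + k * y) y) = pair_row x y *m shear_mx k.
Proof.
by apply/rowP => -[[|[|[|//]]] klt]; rewrite [RHS]mxE big_ord3 !mxE /=; ring.
Qed.

Lemma shear_mx_unit k : shear_mx k \in unitmx.
Proof.
pose X : 'M[C]_3 := \matrix_(i < 3, j < 3)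
  (nth [::] [:: [:: k ^+ 2; - 2 * k; 1]; [:: - k; 1; 0]; [:: 1; 0; 0]] i)`_j.
suff /mulmx1_unit[] : shear_mx k *m X = 1%:M by [].
by apply/matrixP => -[[|[|[|//]]] ilt] [[|[|[|//]]] jlt]; rewrite mxE big_ord3 !mxE /=; ring.
Qed.

Lemma line_form_pair n (a : 'I_n -> C) (M : 'M[C]_3) e s t :
  line_form (pair_line a M e) s t =
  (pair_row (a e.1) (a e.2) *m M *m (pair_row s t)^T) 0 0.
Proof.
rewrite /pair_line /line_form /=; move: (pair_row _ _ *m M) => v.
rewrite [RHS]mxE big_ord3 !mxE /= mulr1.
by congr (v _ _ + v _ _ * _ + v _ _ * _); apply: val_inj.
Qed.

Lemma exists_cube_root n : (0 < n)%N ->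
  exists m, [/\ (0 < m)%N, (m ^ 3 <= n)%N & (n <= 8 * m ^ 3)%N].
Proof.
move=> n0; have ex : exists m, (m ^ 3 <= n)%N by exists 1%N.
have bd m : (m ^ 3 <= n)%N -> (m <= n)%N.
  by move=> le; apply: leq_trans le; case: m => // m; rewrite -{1}(expn1 m.+1) leq_pexp2l.
have [m le max] := ex_maxnP ex bd.
have m0 : (0 < m)%N by apply: max; rewrite exp1n.
exists m; split=> //; have lt : (n < m.+1 ^ 3)%N.
  by rewrite ltnNge; apply/negP => /max; rewrite ltnn.
apply: leq_trans (ltnW lt) _; rewrite -(expnMn 2 m 3) leq_exp2r //; lia.
Qed.

(** [q ^ 3 * n <= 8 * (q * m) ^ 3 <= 8 * k ^ 3 * n ^ 9]; cancel [n]. *)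
Lemma leq_cube_bound k n m q : (0 < n)%N -> (q * m <= k * n ^ 3)%N ->
  (n <= 8 * m ^ 3)%N -> (q ^ 3 <= 8 * k ^ 3 * n ^ 8)%N.
Proof.
move=> n0 qm nm; rewrite -(leq_pmul2r n0).
apply: leq_trans (leq_mul (leqnn _) nm) _.
have -> : (q ^ 3 * (8 * m ^ 3) = 8 * (q * m) ^ 3)%N by ring.
have -> : (8 * k ^ 3 * n ^ 8 * n = 8 * (k * n ^ 3) ^ 3)%N by ring.
by rewrite leq_mul2l leq_exp2r.
Qed.

Lemma coplanar_incidences n (a : 'I_n -> C) (M : 'M[C]_3) (P : 'I_n -> 'rV[C]_4) :
  (forall f : {ffun 'I_4 -> 'I_n}, increasing f ->
     (\rank (\matrix_(k < 4) P (f k)) <= 3)%N ->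
     incident a M (f (o4 0), f (o4 1)) (f (o4 2), f (o4 3))) ->
  (coplanar_quadruples P <= #|[set f : ('I_n * 'I_n) * ('I_n * 'I_n) |
     (f.1.1 < f.1.2)%N && incident a M f.1 f.2]|)%N.
Proof.
move=> cop; apply: (leq_card_injective_rel (r := fun (f : {ffun 'I_4 -> 'I_n}) p =>
  p = ((f (o4 0), f (o4 1)), (f (o4 2), f (o4 3))))).
  move=> f; rewrite inE => /andP[incr rk]; eexists; last by [].
  by rewrite inE /= cop // andbT; move/increasingP: incr; apply.
by move=> f g p _ _ -> [e0 e1 e2 e3]; apply: ffun4P.
Qed.

Lemma second_species_bound (delta : 'rV[C]_4 -> Prop) :
  rational_space_quartic delta -> second_species delta ->
  exists K : nat, forall (n : nat) (P : 'I_n -> 'rV[C]_4),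
    points_on delta P -> (coplanar_quadruples P ^ 3 <= K * n ^ 8)%N.
Proof.
move=> [A [[A_full _ _] dA]] second.
have [c cA] := annihilator_exists A_full.
have Mu : catalecticant c \in unitmx.
  rewrite catalecticant_unit; apply: (second_species_hankel cA A_full _ second).
  by move=> p /dA.
exists (8 * 1077 ^ 3)%N => n P [Pd Pdist].
have [n0|n_gt0] := posnP n.
  have le4 : (coplanar_quadruples P <= n ^ 4)%N.
    by apply: leq_trans (max_card _) _; rewrite card_ffun !card_ord.
  have -> // : coplanar_quadruples P = 0%N.
  by apply/eqP; rewrite -leqn0; apply: leq_trans le4 _; rewrite n0.
have /choice[u uP] : forall i, exists u : 'rV[C]_2, u != 0 /\ proj_eq (P i) (qparam A u).
  by move=> i; apply/dA.
have /choice[d dP] : forall i, exists d : C, d != 0 /\ P i = d *: qparam A (u i).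
  by move=> i; have [] := uP i.
have u0 i : u i != 0 by have [] := uP i.
have u_neq i j : i != j -> bracket (u i) (u j) != 0.
  move=> ij; apply/negP => /eqP/(bracket_eq0 (u0 i) (u0 j))[l l0 uij].
  apply: (Pdist i j ij); have [di Pi] := dP i; have [dj Pj] := dP j.
  exists (d i * l ^+ 4 / d j); split; first by rewrite !mulf_neq0 ?invr_neq0 ?expf_neq0.
  by rewrite Pi Pj uij qparam_scale !scalerA divfK.
(* An affine coordinate [a] in which no parameter is at infinity. *)
have [k kP] := exists_nonroot u0.
pose g i := u i 0 0 - k%:R * u i 0 1; pose a i := u i 0 1 / g i.
have uE i : u i = g i *: point (1 + k%:R * a i) (a i).
  have g0 : g i != 0 := kP i.
  apply/rowP => -[[|[|//]] klt]; rewrite !mxE /= /a.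
    have -> : Ordinal klt = 0 by apply: val_inj.
    by rewrite mulrDr mulr1 mulrCA [g i * _]mulrC divfK // /g subrK.
  have -> : Ordinal klt = 1 by apply: val_inj.
  by rewrite mulrC divfK.
have a_inj : injective a.
  move=> i j aij; apply/eqP; apply: contraT => /u_neq.
  by rewrite (uE i) (uE j) aij /bracket !mxE mulrACA [X in _ - X]mulrACA [X in _ * X - _]mulrC subrr eqxx.
pose N := shear_mx k%:R; pose M := N *m catalecticant c *m N^T.
have Munit : M \in unitmx.
  by rewrite !unitmx_mul unitmx_tr shear_mx_unit Mu.
have cop f : increasing f -> (\rank (\matrix_(k < 4) P (f k)) <= 3)%N ->
    incident a M (f (o4 0), f (o4 1)) (f (o4 2), f (o4 3)).
  move=> incr; have -> : \matrix_(k < 4) P (f k) =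
      \matrix_(k < 4) (d (f k) *: qparam A (u (f k))).
    by apply/row_matrixP => j; rewrite !rowK; have [] := dP (f j).
  rewrite (coplanar_polar cA (U := fun j => u (f j))) //; first last.
  - by move=> i j ij; apply: u_neq; apply: increasing_neq.
  - by move=> j; have [] := dP (f j).
  rewrite polar_catalecticant /= 4!uE !sym2_scale !sym2_point.
  rewrite -!scalemxAl linearZ /= -scalemxAr scalerA mxE mulf_eq0.
  rewrite !mulf_eq0 !(negPf (kP _)) /= /incident line_form_pair /M.
  by rewrite trmx_mul !mulmxA.
have le := coplanar_incidences cop.
have [m [m0 m3 n8]] := exists_cube_root n_gt0.
have mn : (m <= n)%N.
  by apply: leq_trans m3; rewrite -{1}(expn1 m) leq_pexp2l.
have := card_incidences a_inj Munit m0 mn; move: le.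
set q := coplanar_quadruples P; set F := #|_| => le leF.
(* With [m ^ 3 <= n] both terms of the incidence bound are of order [n ^ 3], and
   [1077 = 1024 + 53]. *)
have qm : (q * m <= 1077 * n ^ 3)%N.
  apply: leq_trans (leq_mul le (leqnn m)) _; apply: leq_trans leF _.
  have -> : (1077 * n ^ 3 = 1024 * n ^ 2 * n + 53 * n ^ 3)%N.
    by rewrite -mulnA -expnSr -mulnDl.
  by rewrite leq_add2r leq_mul2l m3 orbT.
exact: leq_cube_bound n_gt0 qm n8.
Qed.
End SecondSpecies.

Theorem theorem1p4 (R : realType) (delta : 'rV[R[i]]_4 -> Prop) :
  rational_space_quartic delta ->
  (first_species delta ->
     exists c1 c2 N : nat, forall n : nat, (N <= n)%N ->
       exists P : 'I_n -> 'rV[R[i]]_4,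
         [/\ points_on delta P,
             (n ^ 3 <= c1 * coplanar_quadruples P)%N &
             (coplanar_quadruples P <= c2 * n ^ 3)%N])
  /\
  (second_species delta ->
     exists K : nat, forall (n : nat) (P : 'I_n -> 'rV[R[i]]_4),
       points_on delta P -> (coplanar_quadruples P ^ 3 <= K * n ^ 8)%N).
Proof.
move=> rat; split; first exact: first_species_count.
exact: second_species_bound.
Qed.
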